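(* Let $K$ be a nonempty compact Hausdorff space, and let $\mathcal{H}$ be a real Hilbert space with $\dim(\mathcal{H})=3$ or $\dim(\mathcal{H})\geq 5$. Then there exists no surjective isometry from the unit sphere of $C(K,\mathcal{H})$ onto the unit sphere of a real von Neumann algebra.
   Context: $C(K,\mathcal{H})$ is the Banach space of all continuous functions from $K$ to $\mathcal{H}$, with the supremum norm. The unit sphere of a Banach space $X$ is $\{x\in X:\|x\|=1\}$, and an isometry between unit spheres is a map preserving the distances induced by the norms. A real von Neumann algebra is a unital, weak-operator closed, real $^*$-subalgebra of the algebra of bounded operators on a real Hilbert space, with the operator norm. *)

(* Defs.v *)
From HB Require Import structures.
From mathcomp Require Import all_boot all_order all_algebra.
From mathcomp Require Import sesquilinear.
From mathcomp Require Import all_classical all_reals all_analysis.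
Import Order.TTheory GRing.Theory Num.Theory.
Import numFieldNormedType.Exports.

Set Implicit Arguments.
Unset Strict Implicit.
Unset Printing Implicit Defensive.

Local Open Scope classical_set_scope.
Local Open Scope card_scope.
Local Open Scope ring_scope.

HB.mixin Record CompleteNormedModule_isHilbert (R : realType) H
    of CompleteNormedModule R H := {
  inner : {dot H for (@idfun R)} ;
  inner_norm : forall x : H, inner x x = `|x| ^+ 2
}.

#[short(type="hilbertType")]
HB.structure Definition Hilbert (R : realType) :=
  {H of CompleteNormedModule_isHilbert R H & CompleteNormedModule R H}.

Definition orthonormal_basis (R : realType) (H : hilbertType R) (B : set H) :=
  (forall x y, B x -> B y -> inner x y = (x == y)%:R) /\
  (forall z : H, (forall x, B x -> inner x z = 0) -> z = 0).

Definition hilbert_dim_eq (R : realType) (H : hilbertType R) (n : nat) :=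
  exists2 B : set H, orthonormal_basis B & B #= `I_n.

(* The dimension may be an infinite cardinal. *)
Definition hilbert_dim_ge (R : realType) (H : hilbertType R) (n : nat) :=
  exists2 B : set H, orthonormal_basis B & `I_n #<= B.

Definition C_space (K : topologicalType) (R : realType) (H : hilbertType R) :
    set (K -> H) :=
  [set f | continuous f].

Definition sup_norm (K : topologicalType) (R : realType) (H : hilbertType R)
    (f : K -> H) : R :=
  sup [set `|f t| | t in [set: K]].

Definition bounded_operator (R : realType) (L : hilbertType R) : set (L -> L) :=
  [set T | linear T /\ exists c : R, forall x, `|T x| <= c * `|x|].

Definition operator_norm (R : realType) (L : hilbertType R) (T : L -> L) : R :=
  sup [set `|T x| | x in [set x : L | `|x| <= 1]].

Definition is_adjoint (R : realType) (L : hilbertType R) (T S : L -> L) :=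
  forall x y : L, inner (T x) y = inner x (S y).

Definition matrix_coefficients (R : realType) (L : hilbertType R) (T : L -> L) :
    {ptws L * L -> R} :=
  fun xy => inner (T xy.1) xy.2.

(* The initial topology for the maps T |-> <T x, y>; it is defined on all maps
   L -> L, and induces the weak operator topology on the bounded operators. *)
Definition weak_operator_topology (R : realType) (L : hilbertType R) :
    topologicalType :=
  initial_topology (@matrix_coefficients R L).

Record real_von_neumann_algebra (R : realType) (L : hilbertType R)
    (M : set (L -> L)) : Prop := {
  vna_bounded : M `<=` @bounded_operator R L ;
  vna_id : M idfun ;
  vna_add : forall S T, M S -> M T -> M (S + T) ;
  vna_scale : forall (a : R) T, M T -> M (a *: T) ;
  vna_comp : forall S T, M S -> M T -> M (S \o T) ;
  vna_adjoint : forall T, M T -> exists2 S, M S & is_adjoint T S ;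
  vna_closed :
    @bounded_operator R L `&` @closure (weak_operator_topology L) M `<=` M
}.

(* The unit sphere of the subspace E of V, for a norm N on E. *)
Definition unit_sphere (R : realType) (V : zmodType) (E : set V) (N : V -> R) :
    set V :=
  [set v | E v /\ N v = 1].

(* Only the values of F on A are constrained. *)
Definition surjective_isometry (R : realType) (U V : zmodType)
    (A : set U) (NU : U -> R) (B : set V) (NV : V -> R) (F : U -> V) :=
  F @` A = B /\
  forall u v, A u -> A v -> NV (F u - F v) = NU (u - v).

(* Main.v *)
From HB Require Import structures.
Require Import Defs.
From mathcomp Require Import all_boot all_order all_algebra.
From mathcomp Require Import sesquilinear ring lra.
From mathcomp Require Import all_classical all_reals all_analysis.
Import Order.TTheory GRing.Theory Num.Theory.
Import numFieldNormedType.Exports.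

Set Implicit Arguments.
Unset Strict Implicit.
Unset Printing Implicit Defensive.

Local Open Scope classical_set_scope.
Local Open Scope ring_scope.

(** The isometry [F] need not be extended linearly; its metric properties
    suffice. If [|u t| = 1] and [F w = - F u] then [w t = - u t], and lower
    bounds for distances to [{z : |z - u| = 2}] bound [|u t + v t|] from below.
    A square-zero [x <> 0] in the algebra [M] would give [x x*], [x], [x* x]
    whose preimages have a common peak point, which is absurd; so [M] has no
    nilpotents and its projections are central. If [|u t| = 1] for all [t], then
    [|V - F u|^2 + |V + F u|^2 >= 4] for all [V] in the unit sphere of [M], and
    spectral projections show that this forces [F u] to be unitary. Hence
    orthonormal vectors of [H], as constant functions, are mapped to unitaries
    [U_i] with [U_i* U_j + U_j* U_i = 0]. Three of them always admit a fourth,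
    and five of them produce a noncentral projection. *)

(** * Operators on a real Hilbert space *)

(** The excluded dimensions 1, 2 and 4 are those of the reals, the complex numbers and the
    quaternions, which are real von Neumann algebras; for a one-point [K] their unit spheres are
    isometric to that of [C(K,H)]. So the dimension must be played against the multiplication of
    [M]: the fourth unitary is the analogue of the quaternion product of two units, and five
    unitaries give Clifford relations that leave too much room for projections. The obstacle is that
    [F] respects neither sums nor products, and that the operator norm obeys no parallelogram law.
    That law does hold in [H], hence at each point of [K]. The metric arguments therefore pull
    operators back along [F], choose a point where a preimage has norm one, and let distances in [M]
    control distances in [H] there. *)

Section InnerProduct.
Context {R : realType} {L : hilbertType R}.
Implicit Types x y z : L.

Lemma innerC x y : inner x y = inner y x.
Proof. by rewrite (hermC inner) expr0 mul1r. Qed.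

Lemma innerDl x y z : inner (x + y) z = inner x z + inner y z.
Proof. exact: linearDl. Qed.

Lemma innerDr x y z : inner z (x + y) = inner z x + inner z y.
Proof. exact: linearDr. Qed.

Lemma innerNl x z : inner (- x) z = - inner x z.
Proof. exact: linearNl. Qed.

Lemma innerNr x z : inner z (- x) = - inner z x.
Proof. exact: linearNr. Qed.

Lemma innerZl a x z : inner (a *: x) z = a * inner x z.
Proof. exact: linearZl_LR. Qed.

Lemma innerZr a x z : inner z (a *: x) = a * inner z x.
Proof. by rewrite innerC innerZl innerC. Qed.

Definition innerE := (innerDl, innerDr, innerNl, innerNr, innerZl, innerZr).

Lemma inner_ge0 x : 0 <= inner x x.
Proof. by rewrite inner_norm sqr_ge0. Qed.

Lemma inner_eq0 x : inner x x = 0 -> x = 0.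
Proof. by rewrite inner_norm => /eqP; rewrite sqrf_eq0 normr_eq0 => /eqP. Qed.

Lemma inner_ext x y : (forall z, inner x z = inner y z) -> x = y.
Proof.
move=> xy; apply/eqP; rewrite -subr_eq0; apply/eqP/inner_eq0.
by rewrite !(innerDl, innerNl) !xy subrr.
Qed.

Lemma norm_sqrD x y : `|x + y| ^+ 2 = `|x| ^+ 2 + `|y| ^+ 2 + 2 * inner x y.
Proof. by rewrite -!inner_norm !innerE (innerC y x); ring. Qed.

Lemma norm_sqrB x y : `|x - y| ^+ 2 = `|x| ^+ 2 + `|y| ^+ 2 - 2 * inner x y.
Proof. by rewrite norm_sqrD normrN innerNr; ring. Qed.

Lemma cauchy_schwarz x y : inner x y <= `|x| * `|y|.
Proof.
have [->|x0] := eqVneq x 0.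
  by rewrite normr0 mul0r linear0l.
have [->|y0] := eqVneq y 0.
  by rewrite normr0 mulr0 linear0r.
have X : 0 < `|x| by rewrite normr_gt0.
have Y : 0 < `|y| by rewrite normr_gt0.
have := sqr_ge0 `| `|y| *: x - `|x| *: y |.
rewrite norm_sqrB !normrZ !normr_id !innerE => h.
rewrite -(ler_pM2l (mulr_gt0 X Y)); nra.
Qed.

Lemma cauchy_schwarz_abs x y : `|inner x y| <= `|x| * `|y|.
Proof.
rewrite ler_norml cauchy_schwarz andbT lerNl -innerNl.
by rewrite (le_trans (cauchy_schwarz _ _)) // normrN.
Qed.

End InnerProduct.

Section Operators.
Context {R : realType} {L : hilbertType R}.
Implicit Types (T S : L -> L) (x y : L).

Lemma linop0 T : linear T -> T 0 = 0.
Proof. by move=> lT; have := lT (-1) 0 0; rewrite scaler0 addr0 scaleN1r addNr. Qed.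

Lemma linopD T x y : linear T -> T (x + y) = T x + T y.
Proof. by move=> lT; rewrite -[x]scale1r lT !scale1r. Qed.

Lemma linopZ T a x : linear T -> T (a *: x) = a *: T x.
Proof. by move=> lT; rewrite -[a *: x]addr0 lT linop0 // addr0. Qed.

Lemma linopN T x : linear T -> T (- x) = - T x.
Proof. by move=> lT; rewrite -scaleN1r linopZ // scaleN1r. Qed.

Lemma linopB T x y : linear T -> T (x - y) = T x - T y.
Proof. by move=> lT; rewrite linopD // linopN. Qed.

Let image_has_sup T : bounded_operator T ->
  has_sup [set `|T x| | x in [set x : L | `|x| <= 1]].
Proof.
move=> [lT [c cT]]; split; first by exists `|T 0|, 0 => //=; rewrite normr0.
exists `|c| => _ [x /= x1 <-].
rewrite (le_trans (cT x))// (le_trans (ler_norm _))// normrM normr_id.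
by rewrite ler_piMr.
Qed.

Lemma operator_norm_ge T x : bounded_operator T -> `|x| <= 1 ->
  `|T x| <= operator_norm T.
Proof.
by move=> bT x1; apply: sup_upper_bound; [exact: image_has_sup | exists x].
Qed.

Lemma operator_normP T x : bounded_operator T ->
  `|T x| <= operator_norm T * `|x|.
Proof.
move=> bT; have [lT _] := bT; have [->|x0] := eqVneq x 0.
  by rewrite linop0 // !normr0 mulr0.
have X : 0 < `|x| by rewrite normr_gt0.
have := @operator_norm_ge T (`|x|^-1 *: x) bT.
rewrite linopZ // !normrZ normfV normr_id mulVf ?gt_eqF // => /(_ (lexx _)).
by rewrite ler_pdivrMl // mulrC.
Qed.

Lemma operator_norm_le T c :
  (forall x, `|x| <= 1 -> `|T x| <= c) -> operator_norm T <= c.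
Proof.
move=> Tc; apply: ge_sup => [|_ [x /= x1 <-]]; last exact: Tc.
by exists `|T 0|, 0 => //=; rewrite normr0.
Qed.

Lemma operator_norm_gt T c : bounded_operator T -> c < operator_norm T ->
  exists2 x, `|x| <= 1 & c < `|T x|.
Proof.
move=> bT cT; have := sup_adherent (eps := operator_norm T - c).
move=> /(_ _ _ (image_has_sup bT)); rewrite subr_gt0 => /(_ cT) [_ [x x1 <-]].
by rewrite /operator_norm subKr => ?; exists x.
Qed.

Lemma operator_norm_ge0 T : bounded_operator T -> 0 <= operator_norm T.
Proof.
by move=> bT; apply: (le_trans _ (operator_norm_ge (x := 0) bT _)); rewrite ?normr0.
Qed.

End Operators.

(** By Cauchy-Schwarz, pointwise norm convergence makes all matrix coefficients converge. This is
    how the limit of a sequence of polynomials in an element is seen to stay in [M]. *)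
Lemma wot_closed_seq (R : realType) (L : hilbertType R) (M : set (L -> L))
    (s_ : nat -> L -> L) (s : L -> L) :
  real_von_neumann_algebra M -> (forall n, M (s_ n)) ->
  bounded_operator s -> (forall x, s_ ^~ x @ \oo --> s x) -> M s.
Proof.
move=> vM Ms bs s_s; apply: (vna_closed vM); split => // B.
have : (fun n => matrix_coefficients (s_ n)) @ \oo --> matrix_coefficients s.
  apply/pointwise_cvgP => -[x y].
  suff : (fun n => inner (s_ n x) y) @ \oo --> inner (s x) y by [].
  apply/cvgrPdist_le => e e0.
  move/cvgrPdist_le : (s_s x) => /(_ (e / (`|y| + 1))).
  rewrite divr_gt0 ?ltr_wpDl // => /(_ isT) [N _ sN].
  exists N => // n /= /sN h.
  rewrite -innerNl -innerDl (le_trans (cauchy_schwarz_abs _ _)) //.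
  rewrite (le_trans (ler_wpM2r _ h)) // -mulrA ler_piMr ?(ltW e0) //.
  by rewrite mulrC ler_pdivrMr ?ltr_wpDl // mul1r lerDl.
move=> cvg [_ [[V oV <-] /= Vs sB]].
have /cvg [N _ /= NO] : nbhs (matrix_coefficients s) V by exact: open_nbhs_nbhs.
exists (s_ N); split => //; apply: sB.
by apply: NO => /=.
Qed.

(** * Continuous functions *)

Section ContinuousFunctions.
Context {R : realType} {K : topologicalType} {H : hilbertType R}.
Context (K_nonempty : [set: K] !=set0) (K_compact : compact [set: K])
        (K_hausdorff : hausdorff_space K).
Implicit Types (u v w y z : K -> H) (t : K).

Lemma sup_norm_attained u : continuous u ->
  exists2 t, `|u t| = sup_norm u & forall s, `|u s| <= `|u t|.
Proof.
move=> cu.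
have [|t _ ut] := @compact_EVT_max K R (fun s => `|u s|) setT K_nonempty K_compact.
  apply: continuous_subspaceT => s.
  by apply: (cvg_comp _ _ (cu s)); exact: norm_continuous.
have {}ut s : `|u s| <= `|u t| by apply: ut; rewrite inE.
exists t => //; apply/eqP; rewrite eq_le; apply/andP; split.
  apply: sup_upper_bound; last by exists t.
  by split; [exists `|u t|, t | exists `|u t| => _ [s _ <-]].
by apply: ge_sup; [exists `|u t|, t | move=> _ [s _ <-]].
Qed.

Lemma sup_norm_ge u t : continuous u -> `|u t| <= sup_norm u.
Proof. by move=> /sup_norm_attained[s <-]. Qed.

Lemma sup_norm_le u c : (forall t, `|u t| <= c) -> sup_norm u <= c.
Proof.
move=> uc; apply: ge_sup; last by move=> _ [t _ <-].
by have [t _] := K_nonempty; exists `|u t|, t.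
Qed.

Lemma bump_function t (O : set K) : nbhs t O ->
  exists h : K -> R, [/\ continuous h, forall s, 0 <= h s <= 1, h t = 1 &
    forall s, ~ O s -> h s = 0].
Proof.
rewrite nbhsE => -[U [oU Ut] UO].
have [h [ch h01 h0 h1]] : exists h : K -> R, [/\ continuous h,
    range h `<=` `[0, 1], h @` (~` U) `<=` [set 0] & h @` [set t] `<=` [set 1]].
  apply/uniform_separatorP.
  move/(@normal_separatorP R) : (compact_normal K_hausdorff K_compact).
  apply => //.
  - exact: open_closedC.
  - exact/accessible_closed_set1/hausdorff_accessible.
  - by apply/seteqP; split => // s [] /[swap] ->.
exists h; split => //.
- by move=> s; have := h01 (h s) (ex_intro2 _ _ s I erefl); rewrite /= in_itv.
- by apply: h1; exists t.
- by move=> s Os; apply: h0; exists s => // /UO.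
Qed.

Local Notation SC := (unit_sphere (@C_space K R H) (@sup_norm K R H)).

Lemma sphere_le u t : SC u -> `|u t| <= 1.
Proof. by move=> [cu <-]; exact: sup_norm_ge. Qed.

Lemma sphereP u t : continuous u -> (forall s, `|u s| <= 1) -> `|u t| = 1 -> SC u.
Proof.
move=> cu u1 ut; split => //; apply/eqP; rewrite eq_le sup_norm_le //=.
by rewrite -ut sup_norm_ge.
Qed.

Lemma continuous_sub u v : continuous u -> continuous v -> continuous (u - v).
Proof. by move=> cu cv t; apply: cvgB; [exact: cu | exact: cv]. Qed.

(** Strict convexity of [H]: where [|u t - v t| = 2], the parallelogram identity leaves nothing for
    [|u t + v t|]. With the next lemma, distance 2 means being antipodal at a common peak. *)
Lemma sphere_dist2 u v : SC u -> SC v -> sup_norm (u - v) = 2 ->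
  exists t, `|u t| = 1 /\ v t = - u t.
Proof.
move=> Su Sv; have [t <- _] := sup_norm_attained (continuous_sub Su.1 Sv.1).
move=> uv; exists t.
have ut := sphere_le t Su; have vt := sphere_le t Sv.
have uv' : `|u t - v t| = 2 by [].
have := norm_sqrB (u t) (v t); have := norm_sqrD (u t) (v t).
rewrite uv' => hD hB.
have := normr_ge0 (u t); have := normr_ge0 (v t) => v0 u0.
have h : `|u t + v t| ^+ 2 <= 0 by nra.
split; first by nra.
apply/eqP; rewrite -addr_eq0 addrC -normr_eq0 -sqrf_eq0 eq_le h.
exact: sqr_ge0.
Qed.

Lemma sphere_dist2_ge u v t : SC u -> SC v -> `|u t| = 1 -> v t = - u t ->
  sup_norm (u - v) = 2.
Proof.
move=> Su Sv ut vt; apply/eqP; rewrite eq_le; apply/andP; split.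
  apply: sup_norm_le => s; rewrite (le_trans (ler_normB _ _)) //.
  by have := sphere_le s Su; have := sphere_le s Sv; lra.
have := sup_norm_ge t (continuous_sub Su.1 Sv.1).
have -> : (u - v) t = 2 *: u t.
  by rewrite -[LHS]/(u t - v t) vt opprK scaler_nat.
by rewrite normrZ ut mulr1 ger0_norm.
Qed.

Lemma antipode_near u y t (e : R) : SC u -> SC y -> `|u t| = 1 -> 0 < e ->
  exists z, [/\ SC z, sup_norm (z - u) = 2 & sup_norm (z - y) <= `|u t + y t| + e].
Proof.
move=> Su Sy ut e0.
have [|h [ch h01 ht hO]] := @bump_function t [set s | `|y t - y s| <= e].
  by move/cvgrPdist_le : (Sy.1 t) => /(_ _ e0).
(* [z] equals [- u t] at [t] and [y] away from [t]. Using the constant [u t] makes [z - y] equal to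
   [- h] times [u t + y s], which is within [e] of [u t + y t] on the support of [h]. *)
pose z s := (- h s) *: u t + (1 - h s) *: y s.
have zt : z t = - u t by rewrite /z ht subrr scale0r addr0 scaleN1r.
have Sz : SC z.
  apply: (@sphereP z t); last by rewrite zt normrN.
    move=> s; apply: cvgD; apply: cvgZ => //; last exact: Sy.1.
    - by apply: cvgN; exact: ch.
    - exact: cvg_cst.
    - by apply: cvgB; [exact: cvg_cst | exact: ch].
  move=> s; rewrite (le_trans (ler_normD _ _)) // !normrZ ut normrN.
  have := sphere_le s Sy; have /andP[h0 h1] := h01 s.
  have -> : `|h s| = h s by exact: ger0_norm.
  have -> : `|1 - h s| = 1 - h s by rewrite ger0_norm ?subr_ge0.
  nra.
exists z; split => //.
  rewrite (@sphere_dist2_ge z u t) //; first by rewrite zt normrN.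
  by rewrite zt opprK.
apply: sup_norm_le => s.
have -> : (z - y) s = (- h s) *: (u t + y t - (y t - y s)).
  rewrite -[LHS]/(z s - y s) /z; have -> : u t + y t - (y t - y s) = u t + y s.
    by rewrite opprB addrA addrAC addrK.
  by rewrite scalerBl scale1r scalerDr !scaleNr [y s - _]addrC addrA addrK.
have /andP[h0 h1] := h01 s.
rewrite normrZ normrN ger0_norm //.
have [yO|yO] := pselect (`|y t - y s| <= e); last first.
  by rewrite hO // mul0r addr_ge0 // ltW.
rewrite (le_trans (ler_piMl _ h1)) // (le_trans (ler_normB _ _)) //.
by rewrite lerD2l.
Qed.

Lemma peak_lower_bound u y t c : SC u -> SC y -> `|u t| = 1 ->
  (forall z, SC z -> sup_norm (z - u) = 2 -> c <= sup_norm (z - y)) ->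
  c <= `|u t + y t|.
Proof.
move=> Su Sy ut uc; apply/ler_addgt0Pr => e e0.
have [z [Sz zu zy]] := antipode_near Su Sy ut e0.
exact: le_trans (uc _ Sz zu) zy.
Qed.

(** The hypothesis involves distances only, so it can be checked through an isometry. It is tested
    on [u] times a bump at [t]: this [y] peaks only where [u] does and only near [t], so [w = - u]
    at some point near [t], and continuity carries this to [t]. *)
Lemma antipode_at_peaks u w t : SC u -> SC w ->
  (forall y, SC y ->
     (forall z, SC z -> sup_norm (z - y) = 2 -> sup_norm (z - u) = 2) ->
     sup_norm (y - w) = 2) ->
  `|u t| = 1 -> w t = - u t.
Proof.
move=> Su Sw Huw ut; apply/eqP; rewrite -addr_eq0 -normr_le0.
apply/ler_addgt0Pr => e e0; rewrite add0r.
have e2 : 0 < e / 2 by rewrite divr_gt0.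
have [|h [ch h01 ht hO]] := @bump_function t
    [set s | `|u t - u s| <= e / 2 /\ `|w t - w s| <= e / 2].
  apply: filterI.
    by move/cvgrPdist_le : (Su.1 t) => /(_ _ e2).
  by move/cvgrPdist_le : (Sw.1 t) => /(_ _ e2).
pose y s := h s *: u s.
have hu s : `|y s| = h s * `|u s|.
  by have /andP[h0 _] := h01 s; rewrite normrZ ger0_norm.
have Sy : SC y.
  apply: (@sphereP y t); last by rewrite hu ht ut mulr1.
    by move=> s; apply: cvgZ; [exact: ch | exact: Su.1].
  by move=> s; rewrite hu; have := h01 s; have := sphere_le s Su; have := normr_ge0 (u s); nra.
have hpeak s : `|y s| = 1 -> h s = 1 /\ `|u s| = 1.
  rewrite hu; have := h01 s; have := sphere_le s Su; have := normr_ge0 (u s).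
  by move=> *; split; nra.
have /(sphere_dist2 Sy Sw) [s [/hpeak[hs us] ws]] : sup_norm (y - w) = 2.
  apply: Huw => // z Sz /(sphere_dist2 Sz Sy)[s [zs yzs]].
  apply: (@sphere_dist2_ge z u s) => //; rewrite -yzs /y.
  have [|-> _] := hpeak s; first by rewrite yzs normrN.
  by rewrite scale1r.
have [us' ws'] : `|u t - u s| <= e / 2 /\ `|w t - w s| <= e / 2.
  by apply: contrapT => /hO; rewrite hs => /eqP; rewrite oner_eq0.
have {}ws : w s = - u s by rewrite ws /y hs scale1r.
have -> : w t + u t = (w t - w s) + (u t - u s).
  by rewrite ws opprK addrACA subrr addr0.
rewrite (le_trans (ler_normD _ _)) //; lra.
Qed.

End ContinuousFunctions.

(** * Peaks of operators *)

Section Adjoints.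
Context {R : realType} {L : hilbertType R}.
Implicit Types S T P Q Z : L -> L.

Lemma bounded_operatorN T : bounded_operator T -> bounded_operator (- T).
Proof.
move=> [lT [c Tc]]; split; last by exists c => x; rewrite normrN.
move=> a x y; rewrite -[LHS]/(- T (a *: x + y)) lT.
by rewrite opprD -scalerN.
Qed.

Lemma bounded_operatorB S T :
  bounded_operator S -> bounded_operator T -> bounded_operator (S - T).
Proof.
move=> [lS [c Sc]] [lT [d Td]]; split.
  move=> a x y; rewrite -[LHS]/(S (a *: x + y) - T (a *: x + y)) lS lT.
  by rewrite opprD addrACA -scalerBr.
exists (c + d) => x; rewrite (le_trans (ler_normB _ _)) // mulrDl.
exact: lerD.
Qed.

Lemma adjointC S T : is_adjoint S T -> is_adjoint T S.
Proof. by move=> ST x y; rewrite innerC -ST innerC. Qed.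

Lemma adjointB S S' T T' :
  is_adjoint S S' -> is_adjoint T T' -> is_adjoint (S - T) (S' - T').
Proof.
move=> SS TT x y.
by rewrite -[LHS]/(inner (S x - T x) y) -[RHS]/(inner x (S' y - T' y)) !innerE SS TT.
Qed.

Lemma adjoint_norm_le S T : bounded_operator S -> is_adjoint S T ->
  operator_norm T <= operator_norm S.
Proof.
move=> bS ST; apply: operator_norm_le => x x1.
have [->|T0] := eqVneq (T x) 0; first by rewrite normr0 operator_norm_ge0.
have T1 : 0 < `|T x| by rewrite normr_gt0.
rewrite -(ler_pM2r T1) -expr2 -inner_norm -ST.
rewrite (le_trans (cauchy_schwarz _ _)) //.
rewrite (le_trans (ler_piMr _ x1)) //.
exact: operator_normP.
Qed.

Lemma adjoint_norm S T : bounded_operator S -> bounded_operator T ->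
  is_adjoint S T -> operator_norm T = operator_norm S.
Proof.
move=> bS bT ST; apply/eqP; rewrite eq_le adjoint_norm_le //.
by rewrite adjoint_norm_le //; exact: adjointC.
Qed.

(* If [Z] is nearly [- P] at a vector [x] where [P] nearly attains its norm,
   then [(Z - Q) x] is nearly [- (P x + Q x)], a sum of two orthogonal unit
   vectors. *)
Lemma peak_orthogonal P Q Z :
  bounded_operator P -> bounded_operator Q -> bounded_operator Z ->
  operator_norm P <= 1 -> operator_norm Z <= 1 ->
  (forall x, inner (P x) (Q x) = 0) ->
  (forall x, `|x| <= 1 -> `|P x| ^+ 2 <= `|Q x|) ->
  operator_norm (Z - P) = 2 -> Num.sqrt 2 <= operator_norm (Z - Q).
Proof.
move=> bP bQ bZ P1 Z1 PQ PQ2 ZP.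
have bZP := bounded_operatorB bZ bP; have bZQ := bounded_operatorB bZ bQ.
have N0 := operator_norm_ge0 bZQ.
set N := operator_norm (Z - Q) in N0 *.
rewrite -[leRHS]ger0_norm // -sqrtr_sqr ler_wsqrtr // leNgt; apply/negP => N2.
(* Precision [eta ^+ 2] in [|Z x - P x|] gives [m <= 2 * eta] by the parallelogram identity, and
   [k ^+ 2 >= 2 - 6 * eta ^+ 2]. As [k <= N + 2 * eta] with [N ^+ 2 = 2 - 20 * eta], the linear
   terms in [eta] contradict the quadratic ones. *)
pose eta := (2 - N ^+ 2) / 20.
have eta0 : 0 < eta by rewrite /eta; lra.
have eta1 : eta <= 1 / 10 by rewrite /eta; have := sqr_ge0 N; lra.
have [|x x1] := @operator_norm_gt _ _ (Z - P) (2 - eta ^+ 2) bZP.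
  by rewrite ZP; nra.
rewrite -[(Z - P) x]/(Z x - P x) => ZPx.
have Px : `|P x| <= 1 by exact: le_trans (operator_norm_ge bP x1) P1.
have Zx : `|Z x| <= 1 by exact: le_trans (operator_norm_ge bZ x1) Z1.
have ZQx : `|Z x - Q x| <= N by exact: (operator_norm_ge bZQ x1).
have PxZ := ler_normB (Z x) (P x).
have Qx := PQ2 x x1.
have e1 := norm_sqrD (Z x) (P x); have e2 := norm_sqrB (Z x) (P x).
have e3 := norm_sqrD (P x) (Q x); rewrite PQ mulr0 addr0 in e3.
have tri : `|P x + Q x| <= `|Z x - Q x| + `|Z x + P x|.
  have -> : P x + Q x = (Z x + P x) - (Z x - Q x).
    by rewrite opprB [Z x + _]addrC -addrA subrKC.
  by rewrite (le_trans (ler_normB _ _)) // addrC.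
move: tri ZQx PxZ Qx e1 e2 e3 ZPx.
have := normr_ge0 (Z x); have := normr_ge0 (P x); have := normr_ge0 (Q x).
have := normr_ge0 (Z x + P x); have := normr_ge0 (P x + Q x).
set m := `|Z x + P x|; set k := `|P x + Q x|; set d := `|Z x - P x|.
set p := `|P x| in Px *; set q := `|Q x|; set z := `|Z x| in Zx *.
set l := `|Z x - Q x|.
move=> k0 m0 q0 p0 z0 tri lN dzp pq e1 e2 e3 hd.
have e4 : eta = (2 - N ^+ 2) / 20 by [].
clearbody m k d p q z l eta N => {PQ PQ2 bP bQ bZ bZP bZQ P1 Z1 ZP}.
have m2 : m ^+ 2 <= (2 * eta) ^+ 2.
  have : m ^+ 2 + d ^+ 2 <= 4 by nra.
  have : (2 - eta ^+ 2) ^+ 2 <= d ^+ 2 by rewrite ler_sqr ?nnegrE; nra.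
  have : 0 <= eta ^+ 2 by nra.
  nra.
have {}m2 : m <= 2 * eta by rewrite -ler_sqr ?nnegrE; nra.
have p1 : 1 - eta ^+ 2 <= p by lra.
have e5 : 0 <= eta ^+ 2 <= 1 / 100 by nra.
have p2 : 1 - 2 * eta ^+ 2 <= p ^+ 2 by nra.
have q2 : 1 - 4 * eta ^+ 2 <= q ^+ 2 by nra.
have k2 : k ^+ 2 <= (N + 2 * eta) ^+ 2 by rewrite ler_sqr ?nnegrE; lra.
have N15 : N <= 3 / 2 by rewrite -ler_sqr ?nnegrE; lra.
nra.
Qed.

End Adjoints.

Section VonNeumannAlgebra.
Context {R : realType} {L : hilbertType R} {M : set (L -> L)}.
Context (vM : real_von_neumann_algebra M).

Lemma vnaN T : M T -> M (- T).
Proof.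
move=> MT; have -> : - T = (-1) *: T; last exact: vna_scale.
by apply/funext => x; rewrite -[RHS]/((-1) *: T x) scaleN1r.
Qed.

Lemma vnaB S T : M S -> M T -> M (S - T).
Proof. by move=> MS MT; apply: vna_add => //; exact: vnaN. Qed.

Lemma vna_lin T : M T -> linear T.
Proof. by move=> /(vna_bounded vM)[]. Qed.

Local Notation SM := (unit_sphere M (@operator_norm R L)).

Lemma operator_normN (T : L -> L) : operator_norm (- T) = operator_norm T.
Proof.
congr sup; apply/seteqP; split => _ [x x1 <-]; exists x => //;
  by rewrite -[(- T) x]/(- T x) normrN.
Qed.

Lemma sphereN T : SM T -> SM (- T).
Proof. by move=> [MT T1]; split; [exact: vnaN | rewrite operator_normN]. Qed.

End VonNeumannAlgebra.

(** * Polynomials of a self-adjoint operator *)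

Section PositiveProduct.
Context {R : realType} {L : hilbertType R}.
Implicit Types P Q T : L -> L.

Definition nonneg_op T := forall x, 0 <= inner (T x) x.

(** A proof without square roots: iterating [p - p ^+ 2] from [P] writes [P] as a sum of squares
    [p_k ^+ 2] plus a nonnegative remainder [p_n], and [P Q] as the sum of the nonnegative
    [p_k Q p_k] plus [p_n Q]. If [P Q] were negative at [x], the norms [|p_n x|] would stay away
    from 0 and the sum of their squares would exceed [|x| ^+ 2]. *)
Lemma nonneg_op_product P Q : linear P -> linear Q ->
  is_adjoint P P -> is_adjoint Q Q -> (forall x, P (Q x) = Q (P x)) ->
  nonneg_op P -> (forall x, inner (P x) x <= `|x| ^+ 2) -> nonneg_op Q ->
  nonneg_op (P \o Q).
Proof.
move=> lP lQ aP aQ PQ P0 P1 Q0 x.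
pose p_ := fix p n := if n is n'.+1 then (fun y => p n' y - p n' (p n' y)) else P.
have p_S n y : p_ n.+1 y = p_ n y - p_ n (p_ n y) by [].
have p_0 : p_ 0%N = P by []; clearbody p_.
have p_P n : [/\ linear (p_ n), is_adjoint (p_ n) (p_ n),
    forall y, p_ n (Q y) = Q (p_ n y), nonneg_op (p_ n) &
    forall y, inner (p_ n y) y <= `|y| ^+ 2].
  elim: n => [|n [lp ap pQ p0 p1]]; first by rewrite p_0; split.
  split.
  - move=> k y z; rewrite !p_S !lp.
    by rewrite opprD addrACA scalerBr.
  - by move=> y z; rewrite !p_S innerDl innerDr innerNl innerNr !ap.
  - by move=> y; rewrite !p_S !pQ linopB.
  (* The identity behind this is [p - p^2 = p (1 - p)^2 + p^2 (1 - p)]. *)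
  - move=> y; rewrite p_S.
    have := p0 (y - p_ n y); have := p1 (p_ n y).
    rewrite linopB // !innerE -!inner_norm !ap => *; lra.
  - move=> y; rewrite p_S innerDl innerNl (ap (p_ n y)).
    have := p1 y; have := inner_ge0 (p_ n y); lra.
have sumP n : inner (P x) x = \sum_(k < n) `|p_ k x| ^+ 2 + inner (p_ n x) x.
  elim: n => [|n IH]; first by rewrite big_ord0 add0r p_0.
  have [_ ap _ _ _] := p_P n.
  by rewrite IH big_ord_recr /= p_S innerDl innerNl (ap (p_ n x)) -inner_norm; ring.
have sumPQ n : inner (P (Q x)) x =
    \sum_(k < n) inner (Q (p_ k x)) (p_ k x) + inner (Q x) (p_ n x).
  elim: n => [|n IH]; first by rewrite big_ord0 add0r p_0 aP.
  have [_ ap pQ _ _] := p_P n.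
  by rewrite IH big_ord_recr /= p_S innerDr innerNr -!(ap (Q x)) !pQ; ring.
rewrite leNgt; apply/negP => PQx.
pose d := - inner (P (Q x)) x.
have d0 : 0 < d by rewrite oppr_gt0.
have dle n : d <= `|Q x| * `|p_ n x|.
  have := cauchy_schwarz (Q x) (- p_ n x); rewrite innerNr normrN.
  have : 0 <= \sum_(k < n) inner (Q (p_ k x)) (p_ k x).
    by apply: sumr_ge0 => k _; exact: Q0.
  by rewrite /d (sumPQ n); lra.
have q0 : 0 < `|Q x|.
  by rewrite lt_neqAle normr_ge0 andbT; apply/eqP => q0; have := dle 0%N; rewrite -q0; lra.
pose c := (d / `|Q x|) ^+ 2.
have c0 : 0 < c by rewrite exprn_gt0 // divr_gt0.
have cle n : c <= `|p_ n x| ^+ 2.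
  by rewrite ler_sqr ?nnegrE ?divr_ge0 ?(ltW d0) // ler_pdivrMr // mulrC.
have nle n : c *+ n <= `|x| ^+ 2.
  rewrite (le_trans _ (P1 x)) // (sumP n).
  have [_ _ _ pn0 _] := p_P n.
  rewrite ler_wpDr ?pn0 //.
  have -> : c *+ n = \sum_(k < n) c by rewrite sumr_const card_ord.
  by apply: ler_sum => k _.
have := archi_boundP (divr_ge0 (sqr_ge0 `|x|) (ltW c0)).
by rewrite ltr_pdivrMr // mulrC mulr_natr ltNge nle.
Qed.

End PositiveProduct.

Section PolynomialCalculus.
Context {R : realType} {L : hilbertType R} (a : L -> L) (la : linear a).
Implicit Types p q : {poly R}.

Definition poly_op p : L -> L := fun x => \sum_(i < size p) p`_i *: iter i a x.

Lemma poly_op_wide p x n : (size p <= n)%N ->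
  poly_op p x = \sum_(i < n) p`_i *: iter i a x.
Proof.
move=> pn; rewrite /poly_op (big_ord_widen n (fun i => p`_i *: iter i a x)) //.
rewrite [RHS](bigID (fun i : 'I_n => i < size p)%N) /= [X in _ = _ + X]big1 ?addr0 //.
by move=> i; rewrite -leqNgt => /leq_sizeP/(_ _ (leqnn _)) ->; rewrite scale0r.
Qed.

Lemma poly_opD p q x : poly_op (p + q) x = poly_op p x + poly_op q x.
Proof.
pose n := maxn (size (p + q)%R) (maxn (size p) (size q)).
rewrite !(@poly_op_wide _ _ n) ?leq_max ?leqnn ?orbT // -big_split.
by apply: eq_bigr => i _; rewrite coefD scalerDl.
Qed.

Lemma poly_opZ c p x : poly_op (c *: p) x = c *: poly_op p x.
Proof.
rewrite (@poly_op_wide _ _ (size p)) ?size_scale_leq // scaler_sumr.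
by apply: eq_bigr => i _; rewrite coefZ scalerA.
Qed.

Lemma poly_opC c x : poly_op c%:P x = c *: x.
Proof.
by rewrite (@poly_op_wide _ _ 1) ?size_polyC_leq1 // big_ord1 coefC.
Qed.

Lemma poly_opMX p x : poly_op (p * 'X) x = a (poly_op p x).
Proof.
rewrite (@poly_op_wide _ _ (size p).+1); last first.
  by have [->|p0] := eqVneq p 0; rewrite ?mul0r ?size_poly0 // size_mulX.
rewrite big_ord_recl coefMX scale0r add0r /poly_op.
rewrite (big_morph a (fun x y => linopD x y la) (linop0 la)).
by apply: eq_bigr => i _; rewrite coefMX /= (linopZ _ _ la).
Qed.

Lemma poly_opX x : poly_op 'X x = a x.
Proof. by rewrite -['X]mul1r poly_opMX -[1]/(1%:P) poly_opC scale1r. Qed.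

Lemma poly_opM p q x : poly_op (p * q) x = poly_op p (poly_op q x).
Proof.
elim/poly_ind: p => [|p c IH]; first by rewrite mul0r -[0]/(0%:P) !poly_opC !scale0r.
rewrite mulrDl poly_opD [LHS]addrC poly_opD [RHS]addrC poly_opC; congr (_ + _).
  by rewrite mul_polyC poly_opZ.
by rewrite -mulrA ['X * q]mulrC mulrA !poly_opMX IH.
Qed.

Lemma poly_opB p q x : poly_op (p - q) x = poly_op p x - poly_op q x.
Proof. by rewrite poly_opD -scaleN1r poly_opZ scaleN1r. Qed.

Lemma poly_op_linear p : linear (poly_op p).
Proof.
have al i : linear (iter i a) by elim: i => [|i IH] k x y //=; rewrite IH la.
move=> k x y; rewrite /poly_op scaler_sumr -big_split; apply: eq_bigr => i _ /=.
by rewrite al scalerDr !scalerA mulrC.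
Qed.

Lemma poly_op_comm p (S : L -> L) x : linear S -> (forall y, S (a y) = a (S y)) ->
  S (poly_op p x) = poly_op p (S x).
Proof.
move=> lS Sa; elim/poly_ind: p => [|p c IH].
  by rewrite -[0]/(0%:P) !poly_opC !scale0r linop0.
by rewrite !poly_opD !poly_opMX !poly_opC linopD // Sa IH linopZ.
Qed.

Lemma poly_op_adjoint p : is_adjoint a a -> is_adjoint (poly_op p) (poly_op p).
Proof.
move=> aa; elim/poly_ind: p => [|p c IH] x y.
  by rewrite -[0]/(0%:P) !poly_opC !scale0r linear0l linear0r.
rewrite !poly_opD !poly_opMX !poly_opC !innerE aa IH; congr (_ + _).
by rewrite (poly_op_comm _ _ la).
Qed.

Lemma poly_op_product p q : is_adjoint a a ->
  nonneg_op (poly_op p) -> nonneg_op (poly_op q) -> bounded_operator (poly_op p) ->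
  nonneg_op (poly_op (p * q)).
Proof.
move=> aa p0 q0 [_ [c pc]].
(* Dividing by [d] brings [p] below the identity; the summand 1 keeps [d] positive. *)
pose d := `|c| + 1.
have d0 : 0 < d by rewrite ltr_wpDl.
suff h : nonneg_op (poly_op (d^-1 *: p) \o poly_op q).
  move=> x; rewrite -(pmulr_rge0 _ (_ : 0 < d^-1)) ?invr_gt0 //.
  by rewrite -innerZl -poly_opZ scalerAl poly_opM; exact: h.
apply: nonneg_op_product; [exact: poly_op_linear|exact: poly_op_linear|
  exact: poly_op_adjoint|exact: poly_op_adjoint| | | |exact: q0].
- by move=> x; rewrite -!poly_opM mulrC.
- by move=> x; rewrite poly_opZ innerZl mulr_ge0 // invr_ge0 ltW.
- move=> x; rewrite poly_opZ innerZl ler_pdivrMl //.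
  rewrite (le_trans (cauchy_schwarz _ _)) // expr2 mulrA ler_wpM2r //.
  rewrite (le_trans (pc x)) // ler_wpM2r // /d.
  by rewrite (le_trans (ler_norm _)) // lerDl.
Qed.

End PolynomialCalculus.

(** * Sign of a self-adjoint element *)

Section SpectralProjection.
Context {R : realType} {L : hilbertType R} {M : set (L -> L)}.
Context (vM : real_von_neumann_algebra M).

Lemma vna_poly_op (a : L -> L) p : M a -> M (poly_op a p).
Proof.
move=> Ma; have la := vna_lin vM Ma; elim/poly_ind: p => [|p c IH].
  have -> : poly_op a 0 = 0 *: idfun.
    by apply/funext => x; rewrite -[0 in LHS]/(0%:P) poly_opC.
  by apply: vna_scale => //; exact: vna_id.
have -> : poly_op a (p * 'X + c%:P) = (a \o poly_op a p) + c *: idfun.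
  by apply/funext => x; rewrite poly_opD // poly_opMX // poly_opC.
apply: vna_add => //; first exact: vna_comp.
by apply: vna_scale => //; exact: vna_id.
Qed.

(** The conclusions describe [s] as the sign of [a]: eigenvalues among -1, 0 and 1, the value 0 only
    where [a] vanishes, and [a s] nonnegative. It is obtained as a pointwise limit of polynomials in
    [a], so no spectral theorem is needed to place it in [M]. *)
Lemma vna_sign_contraction (a : L -> L) : M a -> is_adjoint a a ->
  (forall x, `|a x| <= `|x|) ->
  exists s, [/\ M s, is_adjoint s s, forall x, s (s (s x)) = s x,
    forall x, a (s (s x)) = a x & forall x, 0 <= inner (a (s x)) x].
Proof.
move=> Ma aa a1; have la := vna_lin vM Ma.
have bnd p := vna_bounded vM (vna_poly_op p Ma).
pose pos (p : {poly R}) := nonneg_op (poly_op a p).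
have posD p q : pos p -> pos q -> pos (p + q).
  by move=> p0 q0 x; rewrite poly_opD // innerDl addr_ge0.
have posM p q : pos p -> pos q -> pos (p * q).
  by move=> p0 q0; exact: poly_op_product.
have posC c : 0 <= c -> pos c%:P.
  by move=> c0 x; rewrite poly_opC innerZl mulr_ge0 // inner_ge0.
have sqE p x : inner (poly_op a (p ^+ 2) x) x = `|poly_op a p x| ^+ 2.
  by rewrite expr2 poly_opM // (poly_op_adjoint la p aa) inner_norm.
(* [h] stands for one half in a ring without division. Below, zero terms built from [2 * h = 1] are
   added so that the identities become provable by [ring]. *)
pose h : {poly R} := (2^-1)%:P.
have h2 : 2 * h = 1.
  by rewrite /h -[2]/(2%:R) -polyC_natr -polyCM divff ?pnatr_eq0.
have pos3 : pos 3 by rewrite -polyC_natr; exact: posC.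
have posh : pos h by exact: posC.
(* Newton's iteration [s |-> s (3 - s^2) / 2] for the sign function. *)
pose q_ := fix q n : {poly R} :=
  if n is n'.+1 then q n' * (h * (3 - ('X * q n') ^+ 2)) else 1.
pose s_ n := 'X * q_ n.
have q_S n : q_ n.+1 = q_ n * (h * (3 - s_ n ^+ 2)) by [].
have s_0 : s_ 0%N = 'X by rewrite /s_ /= mulr1.
have s_S n : s_ n.+1 = s_ n * (h * (3 - s_ n ^+ 2)) by rewrite /s_ q_S mulrA.
have q_0 : pos (q_ 0%N) by exact: (posC 1).
have sqE' n : s_ n = 'X * q_ n by [].
clearbody s_ q_.
have e0 n : pos (1 - s_ n ^+ 2).
  elim: n => [|n IH].
    move=> x; rewrite poly_opB // innerDl innerNl sqE s_0 poly_opX // poly_opC.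
    by rewrite scale1r inner_norm subr_ge0 ler_sqr ?nnegrE.
  have -> : 1 - s_ n.+1 ^+ 2 =
      h * h * ((1 - s_ n ^+ 2) ^+ 2 * (3 + (1 - s_ n ^+ 2))).
    rewrite -[RHS]addr0; have -> : 0 = 1 - (2 * h) ^+ 2 by rewrite h2 expr1n subrr.
    by rewrite s_S; ring.
  apply: (posM); first exact: posM.
  by apply: (posM); [move=> x; rewrite sqE sqr_ge0 | exact: posD].
have sle n x : `|poly_op a (s_ n) x| <= `|x|.
  rewrite -ler_sqr ?nnegrE // -subr_ge0 -sqE -inner_norm -innerNl -innerDl.
  by have := e0 n x; rewrite poly_opB // poly_opC scale1r.
(* The [s_ n] follow the sign of [a] and are not monotone, but their cofactors [q_ n] are
   nonnegative and increase. *)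
have dqE n : q_ n.+1 - q_ n = q_ n * h * (1 - s_ n ^+ 2).
  rewrite -[RHS]addr0 -(mulr0 (q_ n)).
  have -> : 0 = 2 * h - 1 by rewrite h2 subrr.
  by rewrite q_S; ring.
have q0 n : pos (q_ n).
  elim: n => // n IH; rewrite -[q_ n.+1](subrK (q_ n)) dqE.
  by apply: (posD) => //; apply: (posM) => //; exact: posM.
have dq0 n k : pos (q_ (n + k)%N - q_ n).
  elim: k => [|k IH]; first by rewrite addn0 subrr -[0]/(0%:P); exact: posC.
  rewrite addnS -[q_ (n + k).+1](subrK (q_ (n + k)%N)) dqE -addrA.
  by apply: (posD) => //; apply: (posM) => //; exact: posM.
pose S n := poly_op a (s_ n).
have lS n : linear (S n) by exact: poly_op_linear.
(* The difference of the two sides comes from [2 s_n (s_m - s_n) = 2 a^2 q_n (q_m - q_n) >= 0],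
   where [m = n + k]. Increments of [S n x] are thus controlled by those of a bounded monotone real
   sequence, which makes [S n x] Cauchy. *)
have dS n k x : `|S (n + k)%N x - S n x| ^+ 2 <= `|S (n + k)%N x| ^+ 2 - `|S n x| ^+ 2.
  have : pos ('X ^+ 2 * (h * 4 * q_ n * (q_ (n + k)%N - q_ n))).
    apply: (posM); first by move=> x'; rewrite sqE.
    apply: (posM) => //; apply: (posM) => //; apply: (posM) => //.
    by rewrite -polyC_natr; exact: posC.
  have -> : 'X ^+ 2 * (h * 4 * q_ n * (q_ (n + k)%N - q_ n)) =
      s_ (n + k)%N ^+ 2 - s_ n ^+ 2 - (s_ (n + k)%N - s_ n) ^+ 2.
    by rewrite !sqE' -[RHS]mul1r -[X in _ = X * _]h2; ring.
  move=> /(_ x); rewrite !poly_opB // !innerDl !innerNl !sqE poly_opB //.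
  by rewrite subr_ge0.
have ndS x : nondecreasing_seq (fun n => `|S n x| ^+ 2).
  move=> n m nm; rewrite -subr_ge0 -(subnKC nm).
  exact: le_trans (sqr_ge0 _) (dS _ _ _).
have cS x : cvgn (fun n => S n x).
  apply/cauchy_cvgP/cauchy_exP => e e0'.
  have fcvg : cvgn (fun n => `|S n x| ^+ 2).
    apply: nondecreasing_is_cvgn => //.
    exists (`|x| ^+ 2) => _ [n _ <-]; rewrite ler_sqr ?nnegrE //; exact: sle.
  have fle := nondecreasing_cvgn_le (ndS x) fcvg.
  move/cvgrPdist_lt : fcvg => /(_ (e ^+ 2)); rewrite exprn_gt0 // => /(_ isT).
  move=> [n _ /(_ n (leqnn n)) /= fn]; exists (S n x); exists n => // m /= nm.
  rewrite -ball_normE /= distrC -ltr_sqr ?nnegrE ?(ltW e0') //.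
  rewrite -(subnKC nm) (le_lt_trans (dS _ _ _)) // (le_lt_trans _ fn) //.
  rewrite (le_trans _ (ler_norm _)) // lerD2r; exact: fle.
pose s x : L := limn (fun n => S n x).
have Ss x : S ^~ x @ \oo --> s x by exact: cS.
have uniq (u : nat -> L) (y z : L) : u @ \oo --> y -> u @ \oo --> z -> y = z.
  by exact: norm_cvg_unique.
have ls : linear s.
  move=> k x y; apply: (uniq _ _ _ (Ss _)).
  have -> : S ^~ (k *: x + y) = fun n => k *: S n x + S n y.
    by apply/funext => n; rewrite lS.
  by apply: cvgD => //; apply: cvgZl_tmp.
have s1 x : `|s x| <= `|x|.
  apply: (cvgr_to_le (cvg_norm (Ss x))); near=> n; exact: sle.
have inner_cvg (u : nat -> L) (y z : L) : u @ \oo --> y ->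
    (fun n => inner (u n) z) @ \oo --> inner y z.
  move=> uy; apply/cvgrPdist_lt => e e0'.
  have z0 : 0 < `|z| + 1 by rewrite ltr_wpDl.
  move/cvgrPdist_lt : uy => /(_ (e / (`|z| + 1))); rewrite divr_gt0 // => /(_ isT).
  apply: filterS => n; rewrite ltr_pdivlMr // => h'.
  rewrite -innerNl -innerDl (le_lt_trans (cauchy_schwarz_abs _ _)) //.
  by rewrite (le_lt_trans _ h') // ler_wpM2l // lerDl.
have sa : is_adjoint s s.
  move=> x y; have := inner_cvg _ _ y (Ss x).
  have -> : (fun n => inner (S n x) y) = (fun n => inner (S n y) x).
    by apply/funext => n; rewrite (poly_op_adjoint la _ aa) innerC.
  move=> Sxy; rewrite [RHS]innerC.
  exact: norm_cvg_unique Sxy (inner_cvg _ _ x (Ss y)).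
have Ms : M s.
  apply: (wot_closed_seq vM _ _ Ss); first by move=> n; exact: vna_poly_op.
  by split => //; exists 1 => x; rewrite mul1r.
have SSs (u : nat -> L) (y : L) : u @ \oo --> y -> (fun n => S n (u n)) @ \oo --> s y.
  move=> uy.
  have -> : (fun n => S n (u n)) = (fun n => S n (u n - y) + S n y).
    by apply/funext => n; rewrite -linopD // subrK.
  rewrite -[s y]add0r; apply: cvgD => //.
  apply/cvgr0Pnorm_lt => e e0'.
  move/cvgrPdist_lt : uy => /(_ _ e0'); apply: filterS => n /=.
  by rewrite distrC; exact: le_lt_trans (sle _ _).
(* Passing to the limit in the recursion gives [s = (3 s - s^3) / 2]. *)
have sss x : s (s (s x)) = s x.
  have := SSs _ _ (SSs _ _ (Ss x)) => sss.
  have : (fun n => S n.+1 x) @ \oo --> 2^-1 *: (3 *: s x - s (s (s x))).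
    have -> : (fun n => S n.+1 x) =
        (fun n => 2^-1 *: (3 *: S n x - S n (S n (S n x)))).
      apply/funext => n; rewrite /S s_S.
      have -> : s_ n * (h * (3 - s_ n ^+ 2)) =
        2^-1 *: (3 *: s_ n - s_ n * (s_ n * s_ n)).
        by rewrite -!mul_polyC -/h polyC_natr; ring.
      by rewrite poly_opZ // poly_opB // poly_opZ // !poly_opM.
    by apply: cvgZl_tmp; apply: cvgB => //; apply: cvgZl_tmp.
  have Ss1 : (fun n => S n.+1 x) @ \oo --> s x by rewrite (cvg_shiftS (S ^~ x)).
  move/(uniq _ _ _ Ss1) => /(congr1 (fun v => 2 *: v)).
  rewrite scalerA mulfV ?pnatr_eq0 // scale1r => /esym e1.
  apply/eqP; rewrite -subr_eq0; apply/eqP.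
  have : 3 *: s x - s (s (s x)) - 2 *: s x = 0 by rewrite e1 subrr.
  rewrite addrAC -scalerBl; have -> : 3 - 2 = 1 :> R by lra.
  by rewrite scale1r => /eqP; rewrite subr_eq0 => /eqP <-; rewrite subrr.
exists s; split => //.
- move=> x; apply/eqP; rewrite -subr_eq0 -linopB // -normr_le0.
  (* [s] kills [y], and [|S n y|] increases from [|a y|] to [|s y| = 0]; so [a y = 0]. *)
  set y := s (s x) - x.
  have sy : s y = 0 by rewrite /y linopB // sss subrr.
  have := Ss y; rewrite sy => /cvg_norm; rewrite normr0 => Sy.
  rewrite -poly_opX // -s_0 -/(S 0%N y).
  apply: (cvgr_to_ge Sy); near=> n.
  by rewrite -ler_sqr ?nnegrE //; exact: ndS.
- move=> x; have := inner_cvg _ _ x (Ss (a x)).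
  rewrite -(uniq _ _ _ (Ss (a x)) (_ : _ --> a (s x))).
    move=> /cvgr_to_ge; apply; near=> n.
    by rewrite /S sqE' poly_opM // poly_opX // aa; exact: q0.
  have -> : S ^~ (a x) = fun n => a (S n x).
    by apply/funext => n; rewrite /S -poly_op_comm.
  apply/cvgrPdist_lt => e e0'; move/cvgrPdist_lt : (Ss x) => /(_ _ e0').
  by apply: filterS => n; rewrite -linopB //; exact: le_lt_trans (a1 _).
Unshelve. all: by end_near.
Qed.

End SpectralProjection.

(** * The algebra has no nilpotents *)

Section Transport.
Context {R : realType} {K : topologicalType} {H : hilbertType R}.
Context (K_nonempty : [set: K] !=set0) (K_compact : compact [set: K])
        (K_hausdorff : hausdorff_space K).
Context {L : hilbertType R} {M : set (L -> L)} {F : (K -> H) -> (L -> L)}.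
Context (vM : real_von_neumann_algebra M).

Local Notation SC := (unit_sphere (@C_space K R H) (@sup_norm K R H)).
Local Notation SM := (unit_sphere M (@operator_norm R L)).
Local Notation N := (@operator_norm R L).

Context (isoF : surjective_isometry SC (@sup_norm K R H) SM N F).

Lemma isometry_sphere u : SC u -> SM (F u).
Proof. by move=> Su; rewrite -isoF.1; exists u. Qed.

Lemma isometry_preimage V : SM V -> exists2 v, SC v & F v = V.
Proof. by rewrite -isoF.1. Qed.

Lemma isometry_dist u v : SC u -> SC v -> N (F u - F v) = sup_norm (u - v).
Proof. exact: isoF.2. Qed.

(** If [F z = - F y], then [z] and [y] are at distance 2. So a [y] whose antipodes are all antipodes
    of [u] satisfies [|F y - F w| = |F y + F u| = |F z - F u| = 2], which is what
    [antipode_at_peaks] requires. *)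
Lemma isometry_opp_peak u w t : SC u -> SC w -> F w = - F u ->
  `|u t| = 1 -> w t = - u t.
Proof.
move=> Su Sw Fw; apply: antipode_at_peaks => // y Sy yu.
have [z Sz Fz] := isometry_preimage (sphereN vM (isometry_sphere Sy)).
have zy : sup_norm (z - y) = 2.
  rewrite -isometry_dist // Fz.
  have -> : - F y - F y = - (2 *: F y) by rewrite scaler_nat opprD.
  rewrite operator_normN; have [MFy Fy1] := isometry_sphere Sy.
  apply/eqP; rewrite eq_le; apply/andP; split.
    apply: operator_norm_le => x x1.
    rewrite -[(2 *: F y) x]/(2 *: F y x) normrZ ger0_norm // ler_piMr //.
    by rewrite -Fy1; apply: operator_norm_ge => //; exact: (vna_bounded vM).
  have b2 := vna_bounded vM (vna_scale vM 2 MFy).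
  apply/ler_addgt0Pr => e e0.
  have [|x x1 xe] := operator_norm_gt (vna_bounded vM MFy) (c := 1 - e / 2).
    by rewrite Fy1; lra.
  have := operator_norm_ge b2 x1.
  rewrite -[(2 *: F y) x]/(2 *: F y x) normrZ ger0_norm //; lra.
have := yu _ Sz zy; rewrite -!isometry_dist // Fz Fw opprK => <-.
by rewrite -opprD operator_normN.
Qed.

(** The preimages of [F p] and [- F p] take opposite values at [t], so both [|p t + q t|] and
    [|p t - q t|] are at least the root of 2. The parallelogram identity then gives
    [2 + 2 |q t|^2 >= 4]. *)
Lemma peak_transfer p q t : SC p -> SC q ->
  (forall Z, SM Z -> N (Z - F p) = 2 -> Num.sqrt 2 <= N (Z - F q)) ->
  (forall Z, SM Z -> N (Z + F p) = 2 -> Num.sqrt 2 <= N (Z - F q)) ->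
  `|p t| = 1 -> `|q t| = 1.
Proof.
move=> Sp Sq pq npq pt.
have [p' Sp' Fp'] := isometry_preimage (sphereN vM (isometry_sphere Sp)).
have p't := isometry_opp_peak Sp Sp' Fp' pt.
have lb : Num.sqrt 2 <= `|p t + q t|.
  apply: peak_lower_bound => // z Sz; rewrite -!isometry_dist //.
  exact: pq (isometry_sphere Sz).
have lb' : Num.sqrt 2 <= `|p t - q t|.
  rewrite -normrN opprB addrC -p't.
  apply: peak_lower_bound => //; first by rewrite p't normrN.
  move=> z Sz; rewrite -!isometry_dist // Fp' opprK.
  exact: npq (isometry_sphere Sz).
have sq2 (r : R) : Num.sqrt 2 <= r -> 2 <= r ^+ 2.
  move=> r2; rewrite -[leLHS](@sqr_sqrtr _ 2) // ler_sqr ?nnegrE ?sqrtr_ge0 //.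
  exact: le_trans r2.
have {}lb' := sq2 _ lb'; have {}lb := sq2 _ lb.
rewrite norm_sqrB pt in lb'; rewrite norm_sqrD pt in lb.
have := sphere_le K_nonempty K_compact t Sq; have := normr_ge0 (q t).
nra.
Qed.

Lemma peak_column p q t : SC p -> SC q ->
  (forall x, inner (F p x) (F q x) = 0) ->
  (forall x, `|x| <= 1 -> `|F p x| ^+ 2 <= `|F q x|) ->
  `|p t| = 1 -> `|q t| = 1.
Proof.
move=> Sp Sq o d; have [MP P1] := isometry_sphere Sp.
have [MQ Q1] := isometry_sphere Sq.
have bP := vna_bounded vM MP; have bQ := vna_bounded vM MQ.
apply: peak_transfer => // Z [MZ Z1]; have bZ := vna_bounded vM MZ => ZP.
  by apply: (peak_orthogonal bP) => //; rewrite ?P1 ?Z1.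
apply: (peak_orthogonal (P := - F p)) => //; rewrite ?operator_normN ?P1 ?Z1 //.
- exact: bounded_operatorN.
- by move=> x; rewrite -[(- F p) x]/(- F p x) innerNl o oppr0.
- by move=> x; rewrite -[(- F p) x]/(- F p x) normrN; exact: d.
- by rewrite opprK.
Qed.

(** Norms do not change under adjoints, so [peak_orthogonal] can be used on the adjoint side when it
    is the adjoints that have orthogonal values. *)
Lemma peak_row p q P' Q' t : SC p -> SC q -> M P' -> M Q' ->
  is_adjoint (F p) P' -> is_adjoint (F q) Q' ->
  (forall x, inner (P' x) (Q' x) = 0) ->
  (forall x, `|x| <= 1 -> `|P' x| ^+ 2 <= `|Q' x|) ->
  `|p t| = 1 -> `|q t| = 1.
Proof.
move=> Sp Sq MP' MQ' aP aQ o d; have [MP P1] := isometry_sphere Sp.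
have [MQ Q1] := isometry_sphere Sq.
have bnd := vna_bounded vM.
have bB S T : M S -> M T -> bounded_operator (S - T).
  by move=> MS MT; apply: bnd; exact: vnaB.
apply: peak_transfer => // Z [MZ Z1]; have [Z' MZ' aZ] := vna_adjoint vM MZ => ZP.
  rewrite -(adjoint_norm (bB _ _ MZ MQ) (bB _ _ MZ' MQ') (adjointB aZ aQ)).
  apply: (peak_orthogonal (P := P')) => //; try exact: bnd.
  - by rewrite (adjoint_norm (bnd _ MP) (bnd _ MP') aP) P1.
  - by rewrite (adjoint_norm (bnd _ MZ) (bnd _ MZ') aZ) Z1.
  - by rewrite (adjoint_norm (bB _ _ MZ MP) (bB _ _ MZ' MP') (adjointB aZ aP)).
rewrite -(adjoint_norm (bB _ _ MZ MQ) (bB _ _ MZ' MQ') (adjointB aZ aQ)).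
have aNP : is_adjoint (- F p) (- P').
  move=> x y; rewrite -[LHS]/(inner (- F p x) y) -[RHS]/(inner x (- P' y)).
  by rewrite !innerE aP.
have MNP := vnaN vM MP; have MNP' := vnaN vM MP'.
apply: (peak_orthogonal (P := - P')) => //; try exact: bnd.
- by rewrite operator_normN (adjoint_norm (bnd _ MP) (bnd _ MP') aP) P1.
- by rewrite (adjoint_norm (bnd _ MZ) (bnd _ MZ') aZ) Z1.
- by move=> x; rewrite -[(- P') x]/(- P' x) innerNl o oppr0.
- by move=> x; rewrite -[(- P') x]/(- P' x) normrN; exact: d.
- by rewrite (adjoint_norm (bB _ _ MZ MNP) (bB _ _ MZ' MNP') (adjointB aZ aNP)) opprK.
Qed.

(* A nonzero square-zero [x], normalized, yields [a = x x*], [b = x],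
   [c = x* x] whose preimages peak at the same points; there the unit vectors
   [a t], [c t] would satisfy [|a t - c t| <= 1] and [|a t + c t| <= 1]. *)
Lemma vna_reduced x : M x -> x \o x = cst 0 -> x = cst 0.
Proof.
move=> Mx0 xx0; have bnd := vna_bounded vM; have lin := vna_lin vM.
apply: contrapT => x0.
have {x0} N0 : 0 < N x.
  rewrite lt_neqAle operator_norm_ge0 ?andbT; last exact: bnd.
  apply/eqP => N0; apply: x0; apply/funext => v; apply/eqP.
  by rewrite -normr_le0 (le_trans (operator_normP v (bnd _ Mx0))) // -N0 mul0r.
pose b : L -> L := (N x)^-1 *: x.
have Mb : M b by exact: vna_scale.
have bE v : b v = (N x)^-1 *: x v by [].
have bb v : b (b v) = 0.
  rewrite !bE (linopZ _ _ (lin _ Mx0)) -[x (x v)]/((x \o x) v) xx0.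
  by rewrite !scaler0.
have b1 : N b = 1.
  apply/eqP; rewrite eq_le; apply/andP; split.
    apply: operator_norm_le => v v1.
    rewrite bE normrZ gtr0_norm ?invr_gt0 // ler_pdivrMl // mulr1.
    exact: (operator_norm_ge (bnd _ Mx0) v1).
  rewrite -(ler_pM2l N0) mulr1; apply: operator_norm_le => v v1.
  rewrite -ler_pdivrMl // -(gtr0_norm (x := (N x)^-1)) ?invr_gt0 // -normrZ -bE.
  exact: (operator_norm_ge (bnd _ Mb) v1).
have [b' Mb' ab] := vna_adjoint vM Mb; have ab' := adjointC ab.
have b'1 : N b' = 1 by rewrite (adjoint_norm (bnd _ Mb) (bnd _ Mb') ab).
move: b bE b' Mb bb b1 Mb' ab ab' b'1 => b _ b' Mb bb b1 Mb' ab ab' b'1.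
have bb' v : b' (b' v) = 0.
  by apply: inner_ext => w; rewrite !ab' bb !linear0r linear0l.
have leb v : `|b v| <= `|v| by rewrite -[leRHS]mul1r -b1; exact: operator_normP (bnd _ Mb).
have leb' v : `|b' v| <= `|v| by rewrite -[leRHS]mul1r -b'1; exact: operator_normP (bnd _ Mb').
have sq (T T' : L -> L) v : is_adjoint T T' -> `|v| <= 1 -> `|T v| ^+ 2 <= `|T' (T v)|.
  move=> aT v1; rewrite -inner_norm aT (le_trans (cauchy_schwarz _ _)) //.
  by rewrite ler_piMl.
have comp1 T T' : M T -> M T' -> is_adjoint T T' -> N T = 1 ->
    (forall v, `|T v| <= `|v|) -> (forall v, `|T' v| <= `|v|) -> SM (T' \o T).
  move=> MT MT' aT T1 lT lT'; have Mc := vna_comp vM MT' MT; split => //.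
  apply/eqP; rewrite eq_le; apply/andP; split.
    by apply: operator_norm_le => v v1; rewrite (le_trans (lT' _)) // (le_trans (lT _)).
  apply/ler_addgt0Pr => e e0.
  have [e1|e1] := leP 1 e.
    by rewrite (le_trans e1) // lerDr; apply: operator_norm_ge0; exact: bnd.
  have [|v v1 vT] := operator_norm_gt (bnd _ MT) (c := 1 - e / 2).
    by rewrite T1; lra.
  have := operator_norm_ge (bnd _ Mc) v1; have := sq _ _ _ aT v1.
  rewrite /=; move: vT; nra.
have Sa : SM (b \o b') by exact: comp1.
have Sc : SM (b' \o b) by exact: comp1.
have [a_ Sa_ Fa] := isometry_preimage Sa.
have [b_ Sb_ Fb] := isometry_preimage (conj Mb b1).
have [c_ Sc_ Fc] := isometry_preimage Sc.
have [t at1 _] := sup_norm_attained K_nonempty K_compact Sa_.1.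
rewrite Sa_.2 in at1.
have bt1 : `|b_ t| = 1.
  apply: (peak_row (P' := b \o b') (Q' := b') Sa_ Sb_ Sa.1 Mb' _ _ _ _ at1).
  - by rewrite Fa => v w /=; rewrite ab ab'.
  - by rewrite Fb.
  - by move=> v /=; rewrite ab bb' linear0r.
  - move=> v v1 /=; have := leb (b' v); have := leb' v.
    have := normr_ge0 (b (b' v)); nra.
have ct1 : `|c_ t| = 1.
  apply: (peak_column Sb_ Sc_ _ _ bt1); rewrite Fb Fc.
  - by move=> v /=; rewrite -ab bb linear0l.
  - by move=> v v1; exact: (sq b b' v ab v1).
have [a' Sa' Fa'] := isometry_preimage (sphereN vM Sa).
have a't : a' t = - a_ t.
  by apply: (isometry_opp_peak Sa_ Sa' _ at1); rewrite Fa' Fa.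
have le1 T : (forall v, `|T v| ^+ 2 = `|b (b' v)| ^+ 2 + `|b' (b v)| ^+ 2) ->
    N T <= 1.
  move=> Tv; apply: operator_norm_le => v v1.
  suff : `|T v| ^+ 2 <= 1 by rewrite -[1 in X in X -> _](expr1n _ 2) ler_sqr ?nnegrE.
  (* [w] is [T* T v] both for the difference and for the sum of [b b'] and [b' b], since [b b = 0]
     removes the cross terms. Hence [r = |T v|^2] satisfies [r^2 <= |w|^2 <= r]. *)
  pose w := b (b' (b (b' v))) + b' (b (b' (b v))).
  have vw : inner v w = `|T v| ^+ 2.
    by rewrite Tv innerDr -!inner_norm !(ab, ab').
  have ww : `|w| ^+ 2 <= `|T v| ^+ 2.
    rewrite Tv norm_sqrD ab bb' linear0r mulr0 addr0 lerD // ler_sqr ?nnegrE //.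
      by rewrite (le_trans (leb _)).
    by rewrite (le_trans (leb' _)).
  have vw1 : `|T v| ^+ 2 <= `|w|.
    by rewrite -vw (le_trans (cauchy_schwarz _ _)) // ler_piMl.
  move: vw1 ww (sqr_ge0 `|T v|); set r := `|T v| ^+ 2; nra.
have ac : `|a_ t - c_ t| <= 1.
  rewrite (le_trans (sup_norm_ge K_nonempty K_compact t (continuous_sub Sa_.1 Sc_.1))) //.
  rewrite -isometry_dist // Fa Fc; apply: le1 => v.
  rewrite -[(_ - _) v]/(b (b' v) - b' (b v)) norm_sqrB.
  by rewrite ab bb' linear0r mulr0 subr0.
have a'c : `|a_ t + c_ t| <= 1.
  rewrite -normrN opprD -a't.
  rewrite (le_trans (sup_norm_ge K_nonempty K_compact t (continuous_sub Sa'.1 Sc_.1))) //.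
  rewrite -isometry_dist // Fa' Fc -opprD operator_normN; apply: le1 => v.
  rewrite -[(_ + _) v]/(b (b' v) + b' (b v)) norm_sqrD.
  by rewrite ab bb' linear0r mulr0 addr0.
have := norm_sqrD (a_ t) (c_ t); have := norm_sqrB (a_ t) (c_ t).
rewrite at1 ct1; have := normr_ge0 (a_ t + c_ t); have := normr_ge0 (a_ t - c_ t).
nra.
Qed.

End Transport.

(** * Central projections *)

Section Projections.
Context {R : realType} {L : hilbertType R} {M : set (L -> L)}.
Context (vM : real_von_neumann_algebra M).

Definition vna_projection (P : L -> L) :=
  [/\ M P, is_adjoint P P & forall x, P (P x) = P x].

Lemma vna_spectral_projection (a : L -> L) : M a -> is_adjoint a a ->
  exists2 P, vna_projection P &
    (forall x, P x = x -> inner (a x) x <= 0) /\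
    (forall x, P x = 0 -> 0 <= inner (a x) x).
Proof.
move=> Ma aa; have [la [c ac]] := vna_bounded vM Ma.
pose d := `|c| + 1.
have d0 : 0 < d by rewrite ltr_wpDl.
have [|||s [Ms ss sss ass as0]] := @vna_sign_contraction _ _ _ vM (d^-1 *: a).
- exact: vna_scale.
- move=> x y; rewrite -[LHS]/(inner (d^-1 *: a x) y) -[RHS]/(inner x (d^-1 *: a y)).
  by rewrite !innerE aa.
- move=> x; rewrite -[(d^-1 *: a) x]/(d^-1 *: a x) normrZ gtr0_norm ?invr_gt0 //.
  rewrite ler_pdivrMl // (le_trans (ac x)) // ler_wpM2r // /d.
  by rewrite (le_trans (ler_norm _)) // lerDl.
have ls := vna_lin vM Ms.
have {}as0 x : 0 <= inner (a (s x)) x.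
  have := as0 x; rewrite -[(d^-1 *: a) _]/(d^-1 *: a _) innerZl.
  by rewrite pmulr_rge0 // invr_gt0.
have {}ass x : a (s (s x)) = a x.
  by have := ass x; apply: scalerI; rewrite invr_neq0 ?gt_eqF.
(* This is the projection onto the eigenspace of [s] for -1; its kernel collects the eigenvalues 0
   and 1. *)
pose P : L -> L := 2^-1 *: ((s \o s) - s).
have PE x : P x = 2^-1 *: (s (s x) - s x) by [].
have MP : M P by apply: vna_scale => //; apply: vnaB => //; exact: vna_comp.
clearbody P.
have half (v : L) : 2^-1 *: (v + v) = v.
  by rewrite -[v + v](scaler_nat 2) scalerA mulVf ?pnatr_eq0 // scale1r.
have sP x : s (P x) = - P x by rewrite !PE linopZ // linopB // sss -scalerN opprB.
exists P.
  split => //.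
  - by move=> x y; rewrite !PE !innerE !ss.
  - by move=> x; rewrite [LHS]PE !sP (linopN _ ls) sP !opprK half.
split=> x Px.
  have sx : s x = - x by rewrite -Px sP.
  by have := as0 x; rewrite sx linopN // innerNl oppr_ge0.
have sx : s (s x) = s x.
  apply/eqP; rewrite -subr_eq0; apply/eqP.
  by apply: (@scalerI _ _ (2^-1 : R)); rewrite ?invr_neq0 ?pnatr_eq0 // -PE Px scaler0.
by rewrite -ass sx; exact: as0.
Qed.

Context (redM : forall x, M x -> x \o x = cst 0 -> x = cst 0).

(** The corners [P m (1 - P)] and [(1 - P) m P] have square zero, hence vanish. *)
Lemma vna_projection_central P m x : vna_projection P -> M m ->
  P (m x) = m (P x).
Proof.
move=> [MP PP PPP] Mm; have lP := vna_lin vM MP; have lm := vna_lin vM Mm.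
have MI : M idfun := vna_id vM.
have h1 y : P (m (y - P y)) = 0.
  rewrite -[LHS]/((P \o (m \o (idfun - P))) y) (redM (x := P \o (m \o (idfun - P)))) //.
    by do 2?apply: vna_comp => //; exact: vnaB.
  apply/funext => z; rewrite -[LHS]/(P (m (P (m (z - P z)) - P (P (m (z - P z)))))).
  by rewrite PPP subrr !linop0.
have h2 y : m (P y) - P (m (P y)) = 0.
  rewrite -[LHS]/(((idfun - P) \o (m \o P)) y) (redM (x := (idfun - P) \o (m \o P))) //.
    apply: vna_comp => //; first exact: vnaB.
    exact: vna_comp.
  apply/funext => z; pose w := m (P z); rewrite -[LHS]/(m (P (w - P w)) - P (m (P (w - P w)))).
  by rewrite (linopB _ _ lP) (PPP w) subrr (linop0 lm) (linop0 lP) // subrr.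
have := h1 x; rewrite (linopB _ _ lm) (linopB _ _ lP) => /eqP.
rewrite subr_eq0 => /eqP ->; apply/esym/eqP.
by rewrite -subr_eq0; apply/eqP; exact: h2.
Qed.

(** Bisection in place of a spectral resolution: the sign of [a - mu] splits the current projection
    into a part where [a <= mu] and a part where [a >= mu], and a nonzero part is kept. Centrality
    makes the product of two projections a projection. *)
Lemma vna_localize (a Q : L -> L) (e : R) : M a -> is_adjoint a a ->
  vna_projection Q -> (exists2 x, Q x = x & x != 0) -> 0 < e ->
  exists P mu, [/\ vna_projection P, exists2 x, P x = x & x != 0,
    forall x, P x = x -> Q x = x &
    forall x, P x = x -> `|inner (a x) x - mu * `|x| ^+ 2| <= e * `|x| ^+ 2].
Proof.
move=> Ma aa pQ nQ e0; have [la [c ac]] := vna_bounded vM Ma.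
have MI : M idfun := vna_id vM.
have step n : exists P mu, [/\ vna_projection P, exists2 x, P x = x & x != 0,
    forall x, P x = x -> Q x = x &
    forall x, P x = x ->
      `|inner (a x) x - mu * `|x| ^+ 2| <= `|c| / 2 ^+ n * `|x| ^+ 2].
  elim: n => [|n [P [mu [pP [y Py y0] PQ Pmu]]]].
    exists Q, 0; split => // x _; rewrite mul0r subr0 expr0 divr1.
    rewrite (le_trans (cauchy_schwarz_abs _ _)) // expr2 mulrA ler_wpM2r //.
    by rewrite (le_trans (ac x)) // ler_wpM2r // ler_norm.
  have Mamu : M (a - mu *: idfun) by apply: vnaB => //; exact: vna_scale.
  have amuE x : inner ((a - mu *: idfun) x) x = inner (a x) x - mu * `|x| ^+ 2.
    by rewrite -[(a - _) x]/(a x - mu *: x) !innerE inner_norm.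
  have [|S pS [Sneg Spos]] := vna_spectral_projection Mamu.
    move=> x z; rewrite -[LHS]/(inner (a x - mu *: x) z) -[RHS]/(inner x (a z - mu *: z)).
    by rewrite !innerE aa.
  have [MS SS SSS] := pS; have [MP PP PPP] := pP.
  have lS := vna_lin vM MS; have lP := vna_lin vM MP.
  have SP x : S (P x) = P (S x) by exact: vna_projection_central x pS MP.
  have e1 : `|c| / 2 ^+ n = 2 * (`|c| / 2 ^+ n.+1).
    by rewrite exprS invfM; field; rewrite expf_neq0.
  (* The witness [y] decides: either it survives in the upper half, or [S y] is a nonzero vector of
     the lower half. The new centre is the midpoint of that half. *)
  have [Sy|Sy] := eqVneq (S y) 0.
    exists (P - (S \o P)), (mu + `|c| / 2 ^+ n.+1).
    have QE x : (P - (S \o P)) x = P x - S (P x) by [].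
    have QP x : (P - (S \o P)) x = x -> P x = x /\ S x = 0.
      rewrite QE => Qx; split.
        by rewrite -{1}Qx linopB // PPP -SP PPP.
      by rewrite -{1}Qx linopB // SSS subrr.
    split.
    - split; first by apply: vnaB => //; exact: vna_comp.
        by move=> x z; rewrite !QE !innerE PP SS PP SP.
      by move=> x; rewrite !QE !(linopB _ _ lP) PPP -!SP PPP linopB // SSS subrr subr0.
    - by exists y => //; rewrite QE Py Sy subr0.
    - by move=> x /QP[/PQ].
    - move=> x /QP[Px Sx]; have := Pmu x Px; rewrite e1.
      have := Spos x Sx; rewrite amuE !ler_norml; have := sqr_ge0 `|x|.
      set r := `|c| / _; set X := `|x| ^+ 2 => *; apply/andP; lra.
  exists (S \o P), (mu - `|c| / 2 ^+ n.+1).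
  have QP x : (S \o P) x = x -> P x = x /\ S x = x.
    move=> /= Qx; split; first by rewrite -{1}Qx -SP PPP.
    by rewrite -{1}Qx SSS.
  split.
  - split; first exact: vna_comp.
      by move=> x z /=; rewrite SS PP SP.
    by move=> x /=; rewrite -SP PPP SSS.
  - by exists (S y) => //=; rewrite -SP SSS Py.
  - by move=> x /QP[/PQ].
  - move=> x /QP[Px Sx]; have := Pmu x Px; rewrite e1.
    have := Sneg x Sx; rewrite amuE !ler_norml; have := sqr_ge0 `|x|.
    set r := `|c| / _; set X := `|x| ^+ 2 => *; apply/andP; lra.
have := archi_boundP (divr_ge0 (normr_ge0 c) (ltW e0)); set n := Num.bound _.
rewrite ltr_pdivrMr // => cn.
have [P [mu [pP nP PQ Pmu]]] := step n.
exists P, mu; split => // x Px; rewrite (le_trans (Pmu x Px)) // ler_wpM2r //.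
rewrite ler_pdivrMr ?exprn_gt0 // (le_trans (ltW cn)) // mulrC ler_wpM2l ?(ltW e0) //.
by rewrite -natrX ler_nat ltnW // ltn_expl.
Qed.

Lemma operator_norm_sqr_le (T : L -> L) c : bounded_operator T ->
  (forall x, `|T x| ^+ 2 <= c * `|x| ^+ 2) -> 0 <= c -> operator_norm T ^+ 2 <= c.
Proof.
move=> bT Tc c0; rewrite -[leRHS]sqr_sqrtr // ler_sqr ?nnegrE ?operator_norm_ge0 //.
apply: operator_norm_le => x x1.
rewrite -ler_sqr ?nnegrE // sqr_sqrtr // (le_trans (Tc x)) // ler_piMr //.
by rewrite -[leRHS](expr1n _ 2) ler_sqr ?nnegrE.
Qed.

Local Notation SM := (unit_sphere M (@operator_norm R L)).
Local Notation N := (@operator_norm R L).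

(* Otherwise there are [k < 1] and a central projection [Q != 0] with
   [|A x| <= k |x|] and [<A x, x>] close to [mu |x|^2] on the range of [Q], and
   [V = Q + mu A (1 - Q)] violates the hypothesis. *)
Lemma vna_isometric (A : L -> L) : SM A ->
  (forall V, SM V -> 4 <= N (V - A) ^+ 2 + N (V + A) ^+ 2) ->
  forall x, `|A x| = `|x|.
Proof.
move=> [MA A1] AV x0; apply/eqP; rewrite eq_le.
have bA := vna_bounded vM MA; have lA := vna_lin vM MA.
have MI : M idfun := vna_id vM.
have leA x : `|A x| <= `|x| by rewrite -[leRHS]mul1r -A1; exact: operator_normP.
rewrite leA /= leNgt; apply/negP => Ax0.
have X0 : 0 < `|x0| by exact: le_lt_trans Ax0.
(* [k] lies strictly between the ratio at [x0] and 1, so the spectral projection of [A* A - k^2]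
   does not kill [x0]. *)
pose k := (`|A x0| / `|x0| + 1) / 2.
have k1 : 0 <= `|A x0| / `|x0| < 1 by rewrite divr_ge0 //= ltr_pdivrMr ?mul1r.
have {k1} k01 : 0 <= k < 1 by rewrite /k; move: k1 => /andP[? ?]; apply/andP; lra.
have k0 : 0 <= k by case/andP: k01.
have kx0 : `|A x0| < k * `|x0|.
  rewrite /k mulrAC mulrDl mul1r divfK ?gt_eqF //; lra.
have [A' MA' aA] := vna_adjoint vM MA.
have Ma : M (A' \o A - k ^+ 2 *: idfun).
  by apply: vnaB => //; [exact: vna_comp | exact: vna_scale].
have aE x : inner ((A' \o A - k ^+ 2 *: idfun) x) x = `|A x| ^+ 2 - k ^+ 2 * `|x| ^+ 2.
  rewrite -[(_ - _) x]/(A' (A x) - k ^+ 2 *: x) !innerE inner_norm.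
  by rewrite innerC -aA inner_norm.
have [|P pP [Pneg Ppos]] := vna_spectral_projection Ma.
  move=> x z; rewrite -[LHS]/(inner (A' (A x) - k ^+ 2 *: x) z).
  rewrite -[RHS]/(inner x (A' (A z) - k ^+ 2 *: z)) !innerE; congr (_ + _).
  by rewrite -aA innerC -aA innerC.
have nP : exists2 x, P x = x & x != 0.
  exists (P x0); first by case: pP.
  apply/eqP => /Ppos; rewrite aE subr_ge0 -exprMn ler_sqr ?nnegrE ?mulr_ge0 //.
  by rewrite leNgt kx0.
(* Two inequalities are wanted: [(k + e)^2 <= k^2 + 3 e], and [k^2 + 3 e < 1] for the final
   contradiction. *)
pose e := (1 - k) / 4.
have e0 : 0 < e by rewrite /e; case/andP: k01; lra.
(* The real part of [A] is self-adjoint and has the same quadratic form as [A]. *)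
have Mr : M (2^-1 *: (A + A')) by apply: vna_scale => //; exact: vna_add.
have [|Q [mu [pQ [x1 Qx1 x10] QP Qmu]]] := vna_localize Mr _ pP nP e0.
  move=> x z; rewrite -[LHS]/(inner (2^-1 *: (A x + A' x)) z).
  rewrite -[RHS]/(inner x (2^-1 *: (A z + A' z))) !innerE aA.
  rewrite [inner (A' x) z]innerC -[inner z (A' x)]aA [inner (A z) x]innerC.
  by congr (_ * _); rewrite addrC.
have {}Qmu x : Q x = x -> `|inner (A x) x - mu * `|x| ^+ 2| <= e * `|x| ^+ 2.
  move=> Qx; have := Qmu x Qx; rewrite -[(_ *: _) x]/(2^-1 *: (A x + A' x)) !innerE.
  rewrite [inner (A' x) x]innerC -aA.
  by have -> : 2^-1 * (inner (A x) x + inner (A x) x) = inner (A x) x by field.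
have QA2 x : Q x = x -> `|A x| ^+ 2 <= k ^+ 2 * `|x| ^+ 2.
  by move=> /QP/Pneg; rewrite aE subr_le0.
have mule : `|mu| <= k + e.
  have X1 : 0 < `|x1| ^+ 2 by rewrite exprn_gt0 // normr_gt0.
  rewrite -(ler_pM2r X1) -[X in _ * X <= _]gtr0_norm // -normrM.
  have := Qmu _ Qx1; have := cauchy_schwarz_abs (A x1) x1.
  have : `|A x1| <= k * `|x1|.
    by rewrite -ler_sqr ?nnegrE ?mulr_ge0 // exprMn; exact: QA2.
  move=> h1 h2 h3; have h4 : `|inner (A x1) x1| <= k * `|x1| ^+ 2.
    by rewrite (le_trans h2) // expr2 mulrA ler_wpM2r.
  move: h3 h4; rewrite !ler_norml mulrDl => /andP[? ?] /andP[? ?]; apply/andP; lra.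
have e4 : e = (1 - k) / 4 by [].
case/andP: k01 => _ k1; clearbody e k.
have [MQ QQ QQQ] := pQ; have lQ := vna_lin vM MQ.
have QA x : Q (A x) = A (Q x) by exact: vna_projection_central x pQ MA.
(* On the range of [Q], the square of [V + s A] is about [1 + 2 s mu + |A x|^2] for unit [x]; off
   it, [V + s A = (s + mu) A] obeys the same bound. The terms [2 s mu] cancel when [s = 1] and
   [s = -1] are added. *)
pose V : L -> L := Q + mu *: (A \o (idfun - Q)).
have MV : M V.
  apply: vna_add => //; apply: vna_scale => //; apply: vna_comp => //.
  exact: vnaB.
have VE x : V x = Q x + mu *: A (x - Q x) by [].
have QI x : Q (x - Q x) = 0 by rewrite (linopB _ _ lQ) QQQ subrr.
have QAI x : Q (A (x - Q x)) = 0 by rewrite QA QI linop0.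
have pyth x w : Q w = 0 -> `|Q x + w| ^+ 2 = `|Q x| ^+ 2 + `|w| ^+ 2.
  by move=> Qw; rewrite norm_sqrD QQ Qw linear0r mulr0 addr0.
have pythI x : `|x| ^+ 2 = `|Q x| ^+ 2 + `|x - Q x| ^+ 2.
  by rewrite -pyth // subrKC.
have mu2 : mu ^+ 2 <= (k + e) ^+ 2.
  by rewrite -[mu ^+ 2]ger0_norm ?sqr_ge0 // normrX ler_sqr ?nnegrE // addr_ge0 // ltW.
have leA2 x : `|A x| ^+ 2 <= `|x| ^+ 2 by rewrite ler_sqr ?nnegrE.
have SV : SM V.
  split => //; apply/eqP; rewrite eq_le; apply/andP; split.
    apply: operator_norm_le => x xle1; rewrite (le_trans _ xle1) //.
    rewrite -ler_sqr ?nnegrE // VE pyth; last by rewrite (linopZ _ _ lQ) QAI scaler0.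
    rewrite [leRHS]pythI lerD2l normrZ exprMn -normrX ger0_norm ?sqr_ge0 //.
    have := leA2 (x - Q x); have := sqr_ge0 `|A (x - Q x)|.
    have : mu ^+ 2 <= 1 by nra.
    have := sqr_ge0 mu; nra.
  have X1 : 0 < `|x1| by rewrite normr_gt0.
  rewrite -(ler_pM2r X1) mul1r -{1}[x1]Qx1.
  have -> : Q x1 = V x1 by rewrite VE Qx1 subrr linop0 // scaler0 addr0.
  exact: operator_normP (vna_bounded vM MV).
have bound (s : R) : s ^+ 2 = 1 ->
    N (V + s *: A) ^+ 2 <= 1 + 2 * s * mu + (k ^+ 2 + 3 * e).
  move=> s2.
  have smu : (s + mu) ^+ 2 <= 1 + 2 * s * mu + (k ^+ 2 + 3 * e) by nra.
  apply: operator_norm_sqr_le.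
  - by apply: (vna_bounded vM); apply: vna_add => //; exact: vna_scale.
  - move=> x.
    have -> : (V + s *: A) x = Q (x + s *: A x) + (s + mu) *: A (x - Q x).
      rewrite -[LHS]/(V x + s *: A x) VE (linopD _ _ lQ) (linopZ _ _ lQ) QA.
      rewrite (linopB _ _ lA) scalerDl [s *: (_ - _)]scalerBr -!addrA; congr (_ + _).
      by rewrite [LHS]addrC [RHS]addrCA; congr (_ + _); rewrite addrA subrr add0r.
    rewrite pyth; last by rewrite (linopZ _ _ lQ) QAI scaler0.
    rewrite (linopD _ _ lQ) (linopZ _ _ lQ) QA norm_sqrD innerZr !normrZ !exprMn.
    rewrite -!normrX s2 normr1 mul1r !(ger0_norm (sqr_ge0 _)) [X in _ <= _ * X]pythI mulrDr.
    have hA := QA2 _ (QQQ x); have hA' := leA2 (x - Q x).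
    have := Qmu _ (QQQ x); rewrite ler_norml innerC => /andP[hm hM].
    have y0 := sqr_ge0 `|Q x|; have w0 := sqr_ge0 `|A (x - Q x)|.
    apply: lerD; last by rewrite (ler_pM (sqr_ge0 _)) // sqr_ge0.
    have : s = 1 \/ s = -1.
      by move/eqP: s2; rewrite sqrf_eq1 => /orP[]/eqP ->; [left|right].
    by case=> ->; nra.
  - by apply: le_trans smu; exact: sqr_ge0.
have := AV V SV; have := bound 1; have := bound (-1).
rewrite scale1r scaleN1r expr1n sqrrN expr1n => /(_ erefl) + /(_ erefl).
nra.
Qed.

Lemma vna_isometric_unitary (A A' : L -> L) : M A -> M A' -> is_adjoint A A' ->
  (forall x, `|A x| = `|x|) ->
  (forall x, A' (A x) = x) /\ (forall x, A (A' x) = x).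
Proof.
move=> MA MA' aA A1; have lA := vna_lin vM MA; have lA' := vna_lin vM MA'.
have A'A x : A' (A x) = x.
  apply: inner_ext => z; rewrite (adjointC aA).
  have := norm_sqrD (A x) (A z); rewrite -linopD // !A1 norm_sqrD; lra.
split => // x.
have pq : vna_projection (idfun - (A \o A')).
  have qE y : (idfun - (A \o A')) y = y - A (A' y) by [].
  split.
  - by apply: vnaB => //; [exact: vna_id | exact: vna_comp].
  - by move=> y z; rewrite !qE !innerE aA (adjointC aA).
  - by move=> y; rewrite !qE linopB // A'A subrr linop0 // subr0.
have := vna_projection_central x pq MA.
rewrite -[LHS]/(A x - A (A' (A x))) A'A subrr => /(congr1 Num.norm).
rewrite normr0 A1 => /esym/eqP; rewrite normr_eq0 => /eqP.
by rewrite -[LHS]/(x - A (A' x)) => /eqP; rewrite subr_eq0 => /eqP.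
Qed.

End Projections.

(** * Orthonormal frames *)

Section OrthonormalFamilies.
Context {R : realType} {H : hilbertType R}.

Lemma orthonormal_family n (B : set H) : orthonormal_basis B ->
  (`I_n #<= B)%card ->
  exists e : nat -> H, (forall i, (i < n)%N -> B (e i)) /\
    forall i j, (i < n)%N -> (j < n)%N -> inner (e i) (e j) = (i == j)%:R.
Proof.
move=> [oB _] /pcard_leP[f]; exists f.
have fB i : (i < n)%N -> B (f i) by move=> ni; exact: funS.
split => // i j ni nj; rewrite oB; [|exact: fB..].
have [->|ij] := eqVneq i j; first by rewrite eqxx.
by case: eqP => // /(inj (f := f)) fij; rewrite fij ?inE ?eqxx in ij.
Qed.

Lemma orthonormal_family_total n (B : set H) : orthonormal_basis B ->
  (B #= `I_n)%card ->
  exists e : nat -> H,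
    (forall i j, (i < n)%N -> (j < n)%N -> inner (e i) (e j) = (i == j)%:R) /\
    forall z, (forall i, (i < n)%N -> inner (e i) z = 0) -> z = 0.
Proof.
move=> oB; rewrite card_eq_sym => /card_set_bijP[f [fB finj fsurj]]; exists f; split.
  move=> i j ni nj; rewrite oB.1; [|exact: fB..].
  have [->|ij] := eqVneq i j; first by rewrite eqxx.
  by case: eqP => // /finj fij; rewrite fij ?inE ?eqxx in ij.
move=> z fz; apply: oB.2 => x /fsurj[i ni <-]; exact: fz.
Qed.

End OrthonormalFamilies.

(** * Images of frames of constant functions *)

Section MainTheorem.
Context {R : realType} {K : topologicalType} {H : hilbertType R}.
Context (K_nonempty : [set: K] !=set0) (K_compact : compact [set: K])
        (K_hausdorff : hausdorff_space K).
Context {L : hilbertType R} {M : set (L -> L)} {F : (K -> H) -> (L -> L)}.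
Context (vM : real_von_neumann_algebra M).

Local Notation SC := (unit_sphere (@C_space K R H) (@sup_norm K R H)).
Local Notation SM := (unit_sphere M (@operator_norm R L)).
Local Notation N := (@operator_norm R L).

Context (isoF : surjective_isometry SC (@sup_norm K R H) SM N F).

Implicit Types u v : K -> H.

Lemma isometry_opp u : SC u -> (forall t, `|u t| = 1) -> F (- u) = - F u.
Proof.
move=> Su u1.
have [w Sw Fw] := isometry_preimage isoF (sphereN vM (isometry_sphere isoF Su)).
rewrite -Fw; congr F; apply/funext => t.
by rewrite (isometry_opp_peak K_nonempty K_compact K_hausdorff vM isoF Su Sw Fw (u1 t)).
Qed.

Lemma sphere_opp u : SC u -> SC (- u).
Proof.
move=> Su; have [t ut _] := sup_norm_attained K_nonempty K_compact Su.1.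
apply: (sphereP K_nonempty K_compact (t := t)).
- by move=> s; apply: cvgN; exact: Su.1.
- move=> s; rewrite -[(- u) s]/(- u s) normrN.
  exact: (sphere_le K_nonempty K_compact).
- by rewrite -[(- u) t]/(- u t) normrN ut Su.2.
Qed.

(** At a peak [t] of [v], both [u t] and [v t] are unit vectors, so the parallelogram identity in
    [H] yields the bound 4 required by [vna_isometric]. *)
Lemma image_isometric u : SC u -> (forall t, `|u t| = 1) ->
  forall x, `|F u x| = `|x|.
Proof.
move=> Su u1; apply: (vna_isometric vM).
- exact: (vna_reduced K_nonempty K_compact K_hausdorff vM isoF).
- exact: isometry_sphere Su.
move=> V /(isometry_preimage isoF)[v Sv <-].
have Snu := sphere_opp Su.
have -> : F v + F u = F v - F (- u) by rewrite isometry_opp // opprK.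
rewrite !(isometry_dist isoF) // opprK.
have [t vt _] := sup_norm_attained K_nonempty K_compact Sv.1.
rewrite Sv.2 in vt.
have h1 : `|v t - u t| <= sup_norm (v - u).
  exact: (sup_norm_ge K_nonempty K_compact t (continuous_sub Sv.1 Su.1)).
have h2 : `|v t + u t| <= sup_norm (v + u).
  have := sup_norm_ge K_nonempty K_compact t (continuous_sub Sv.1 Snu.1).
  by rewrite opprK.
have -> : 4 = `|v t - u t| ^+ 2 + `|v t + u t| ^+ 2.
  by rewrite norm_sqrB norm_sqrD vt u1; lra.
apply: lerD; rewrite ler_sqr ?nnegrE //; first exact: le_trans (normr_ge0 _) h1.
exact: le_trans (normr_ge0 _) h2.
Qed.

(** By Pythagoras in [H], [u] is at distance at most the root of 2 from [v] and from [- v]. For the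
    isometric [F u] and [F v] this bounds [<F u x, F v x>] by 0 from both sides; polarization does
    the rest. *)
Lemma image_orthogonal u v : SC u -> SC v -> (forall t, `|u t| = 1) ->
  (forall t, `|v t| = 1) -> (forall t, inner (u t) (v t) = 0) ->
  forall x y, inner (F u x) (F v y) = - inner (F u y) (F v x).
Proof.
move=> Su Sv u1 v1 uv; have Snv := sphere_opp Sv.
have [MU _] := isometry_sphere isoF Su; have [MV _] := isometry_sphere isoF Sv.
have Nsqr (w : K -> H) : continuous w -> (forall t, `|w t| ^+ 2 = 2) -> sup_norm w ^+ 2 <= 2.
  move=> cw w2; have [t <- _] := sup_norm_attained K_nonempty K_compact cw.
  by rewrite w2.
have bound (T : L -> L) x : M T -> N T ^+ 2 <= 2 -> `|T x| ^+ 2 <= 2 * `|x| ^+ 2.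
  move=> MT NT; have bT := vna_bounded vM MT.
  have := operator_normP x bT; rewrite -ler_sqr ?nnegrE ?mulr_ge0 ?operator_norm_ge0 //.
  move/le_trans; apply; rewrite exprMn ler_wpM2r // sqr_ge0 //.
have orth x : inner (F u x) (F v x) = 0.
  have h1 : `|F u x - F v x| ^+ 2 <= 2 * `|x| ^+ 2.
    apply: (bound (F u - F v)); first exact: vnaB.
    rewrite (isometry_dist isoF) //; apply: Nsqr; first exact: continuous_sub Su.1 Sv.1.
    by move=> t; rewrite -[(u - v) t]/(u t - v t) norm_sqrB u1 v1 uv; lra.
  have h2 : `|F u x + F v x| ^+ 2 <= 2 * `|x| ^+ 2.
    rewrite -[F v x]opprK -[- F v x]/((- F v) x) -isometry_opp //.
    apply: (bound (F u - F (- v))).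
      by apply: vnaB => //; exact: (isometry_sphere isoF Snv).1.
    rewrite (isometry_dist isoF) //; apply: Nsqr; first exact: continuous_sub Su.1 Snv.1.
    by move=> t; rewrite opprK -[(u + v) t]/(u t + v t) norm_sqrD u1 v1 uv; lra.
  move: h1 h2; rewrite norm_sqrB norm_sqrD !image_isometric //; lra.
move=> x y; have := orth (x + y).
have lU := vna_lin vM MU; have lV := vna_lin vM MV.
rewrite (linopD _ _ lU) (linopD _ _ lV) !innerE !orth; lra.
Qed.

Lemma constant_sphere (e : H) : `|e| = 1 -> SC (cst e).
Proof.
move=> e1; have [t _] := K_nonempty.
apply: (sphereP K_nonempty K_compact (t := t)) => //.
  by move=> s; exact: cvg_cst.
by move=> s; rewrite /= e1.
Qed.

Section Frame.
Context {n : nat} {e : nat -> H}.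
Context (oe : forall i j, (i < n)%N -> (j < n)%N -> inner (e i) (e j) = (i == j)%:R).

Lemma frame_unit i : (i < n)%N -> `|e i| = 1.
Proof.
move=> ni; apply/eqP; by rewrite -(@eqrXn2 _ 2) // expr1n -inner_norm oe // eqxx.
Qed.

Let U i := F (cst (e i)).

Lemma frame_sphere i : (i < n)%N -> SC (cst (e i)).
Proof. by move=> ni; apply: constant_sphere; exact: frame_unit. Qed.

Lemma frame_isometric i x : (i < n)%N -> `|U i x| = `|x|.
Proof.
move=> ni; apply: image_isometric; first exact: frame_sphere.
by move=> t; exact: frame_unit.
Qed.

Lemma frame_vna i : (i < n)%N -> M (U i).
Proof. by move=> /frame_sphere/(isometry_sphere isoF)[]. Qed.

Lemma frame_orthogonal i j x y : (i < n)%N -> (j < n)%N -> i != j ->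
  inner (U i x) (U j y) = - inner (U i y) (U j x).
Proof.
move=> ni nj ij; apply: image_orthogonal; try exact: frame_sphere.
- by move=> t; exact: frame_unit.
- by move=> t; exact: frame_unit.
- by move=> t; rewrite oe // (negbTE ij).
Qed.

Lemma frame_adjoint : exists U' : nat -> L -> L,
  (forall i, (i < n)%N ->
     [/\ M (U' i), is_adjoint (U i) (U' i), forall x, U' i (U i x) = x &
         forall x, U i (U' i x) = x]) /\
  (forall i j, (i < n)%N -> (j < n)%N -> i != j ->
     (forall x, U' j (U i x) = - U' i (U j x)) /\
     (forall x, U i (U' j x) = - U j (U' i x))).
Proof.
have /choice[U' U'P] : forall i, exists T, (i < n)%N ->
    [/\ M T, is_adjoint (U i) T, forall x, T (U i x) = x & forall x, U i (T x) = x].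
  move=> i; have [ni|] := ltnP i n; last by exists idfun.
  have [T MT aT] := vna_adjoint vM (frame_vna ni); exists T => _.
  have [] := vna_isometric_unitary vM _ (frame_vna ni) MT aT
    (fun x => frame_isometric x ni) => //.
  exact: (vna_reduced K_nonempty K_compact K_hausdorff vM isoF).
exists U'; split => // i j ni nj ij.
have [Mi ai U'Ui UU'i] := U'P _ ni; have [Mj aj U'Uj UU'j] := U'P _ nj.
have U'U x : U' j (U i x) = - U' i (U j x).
  apply: inner_ext => z; rewrite (adjointC aj) innerNl (adjointC ai).
  by rewrite (frame_orthogonal x z ni nj ij) [X in - X]innerC.
split => // x; rewrite -{1}[x]UU'i.
by rewrite U'U (linopN _ (vna_lin vM (frame_vna ni))) UU'i.
Qed.

Lemma frame_nonzero : (0 < n)%N -> exists x : L, x != 0.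
Proof.
move=> n0; apply: contrapT => /forallNP x0.
have [MU U1] := isometry_sphere isoF (frame_sphere n0).
have : N (U 0%N) <= 0.
  apply: operator_norm_le => x _; have /negP := x0 x; rewrite negbK => /eqP ->.
  by rewrite linop0 ?normr0 //; exact: vna_lin MU.
by rewrite U1 ler10.
Qed.

(* [U_1 U_0^* U_2] would be a fourth member of the frame. *)
Lemma frame_not3 : n = 3 ->
  (forall z, (forall i, (i < n)%N -> inner (e i) z = 0) -> z = 0) -> False.
Proof.
move=> n3 total.
have n0 : (0 < n)%N by rewrite n3.
have n1 : (1 < n)%N by rewrite n3.
have n2 : (2 < n)%N by rewrite n3.
have [U' [UP rel]] := frame_adjoint.
have [M0 a0 U'U0 UU'0] := UP _ n0; have [M1 a1 U'U1 UU'1] := UP _ n1.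
pose W := U 1%N \o (U' 0%N \o U 2).
have WE x : W x = U 1%N (U' 0%N (U 2 x)) by [].
have MW : M W by do 2?apply: vna_comp => //; exact: frame_vna.
have W1 x : `|W x| = `|x|.
  by rewrite WE frame_isometric // -(frame_isometric _ n0) UU'0 frame_isometric.
have orth i j x : (i < n)%N -> (j < n)%N -> i != j -> inner (U i x) (U j x) = 0.
  by move=> ni nj ij; have := frame_orthogonal x x ni nj ij; lra.
have oW i x : (i < n)%N -> inner (W x) (U i x) = 0.
  rewrite n3; case: i => [|[|[|//]]] _.
  (* Exchanging the first two factors rewrites [W] as [- U_0 U_1* U_2], which exposes [U_0] in
     front. *)
  - rewrite WE (rel 1%N 0%N n1 n0 isT).2 innerNl a0 U'U0 (adjointC a1).
    by rewrite orth ?oppr0.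
  - by rewrite WE a1 U'U1 (adjointC a0) orth.
  - by rewrite WE -[X in inner _ X]UU'0 orth.
have [y y0] := frame_nonzero n0.
have SW : SM W.
  split => //; apply/eqP; rewrite eq_le; apply/andP; split.
    by apply: operator_norm_le => x; rewrite W1.
  have Y : 0 < `|y| by rewrite normr_gt0.
  rewrite -(ler_pM2r Y) mul1r -{1}W1.
  exact: operator_normP (vna_bounded vM MW).
have [w Sw Fw] := isometry_preimage isoF SW.
have [t wt _] := sup_norm_attained K_nonempty K_compact Sw.1.
rewrite Sw.2 in wt.
have bound T v : SC v -> F v = T -> (forall x, `|W x - T x| ^+ 2 = 2 * `|x| ^+ 2) ->
    `|w t - v t| ^+ 2 <= 2.
  move=> Sv Fv WT; have MT : M T by rewrite -Fv; exact: (isometry_sphere isoF Sv).1.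
  have bWT : bounded_operator (W - T) by apply: (vna_bounded vM); exact: vnaB.
  have h : `|w t - v t| <= N (W - T).
    rewrite -Fw -Fv (isometry_dist isoF) //.
    exact: (sup_norm_ge K_nonempty K_compact t (continuous_sub Sw.1 Sv.1)).
  rewrite (@le_trans _ _ (N (W - T) ^+ 2)) //.
    by rewrite ler_sqr ?nnegrE // operator_norm_ge0.
  apply: operator_norm_sqr_le => // x.
  by rewrite -[(W - T) x]/(W x - T x) WT.
(* Orthogonality to every [U i] bounds the distances from [w t] to [e i] and to [- e i], which
   forces the unit vector [w t] to be orthogonal to the whole basis. *)
suff wt0 : w t = 0 by move: wt; rewrite wt0 normr0 => /esym/eqP; rewrite oner_eq0.
apply: total => i ni.
have Se := frame_sphere ni.
have h1 : `|w t - e i| ^+ 2 <= 2.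
  apply: (bound (U i) (cst (e i))) => // x.
  by rewrite norm_sqrB oW // W1 frame_isometric //; ring.
have h2 : `|w t + e i| ^+ 2 <= 2.
  rewrite -[e i]opprK; apply: (bound (- U i) (- cst (e i))).
  - exact: sphere_opp.
  - by rewrite isometry_opp // => s; exact: frame_unit.
  - move=> x; rewrite -[(- U i) x]/(- U i x) opprK.
    by rewrite norm_sqrD oW // W1 frame_isometric //; ring.
move: h1 h2; rewrite norm_sqrB norm_sqrD wt frame_unit // innerC; lra.
Qed.

(* With [J_k = U_0^* U_k], anticommuting square roots of [-1], the symmetry
   [s = J_3 J_1 J_2] commutes with the projection [(1 + s) / 2], which is
   central, yet anticommutes with [J_4]. *)
Lemma frame_lt5 : (n < 5)%N.
Proof.
rewrite ltnNge; apply/negP => n5.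
have lt k : (k < 5)%N -> (k < n)%N by move=> /leq_trans; exact.
have [U' [UP rel]] := frame_adjoint.
have n0 := lt 0%N isT; have [M0 a0 U'U0 UU'0] := UP _ n0.
pose J k := U' 0%N \o U k.
have JE k x : J k x = U' 0%N (U k x) by [].
have MJ k : (k < n)%N -> M (J k) by move=> nk; apply: vna_comp => //; exact: frame_vna.
have lJ k : (k < n)%N -> linear (J k) by move=> nk; exact: (vna_lin vM (MJ k nk)).
have J1 k x : (k < n)%N -> `|J k x| = `|x|.
  by move=> nk; rewrite JE -(frame_isometric _ n0) UU'0 frame_isometric.
have JJ k l x : (k < n)%N -> (l < n)%N -> k != 0%N -> J k (J l x) = - U' k (U l x).
  move=> nk nl k0; rewrite !JE (rel k 0%N nk n0 k0).2.
  by rewrite (linopN _ (vna_lin vM M0)) U'U0.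
have Jsq k x : (k < n)%N -> k != 0%N -> J k (J k x) = - x.
  by move=> nk k0; rewrite JJ //; have [_ _ -> _] := UP _ nk.
have JC k l x : (k < n)%N -> (l < n)%N -> k != 0%N -> l != 0%N -> k != l ->
    J k (J l x) = - J l (J k x).
  by move=> nk nl k0 l0 kl; rewrite !JJ // (rel k l nk nl kl).1 !opprK.
have aJ k x y : (k < n)%N -> k != 0%N -> inner (J k x) y = - inner x (J k y).
  move=> nk k0; rewrite !JE (adjointC a0) [inner x _]innerC (adjointC a0).
  exact: frame_orthogonal.
have n1 := lt 1%N isT; have n2 := lt 2%N isT; have n3 := lt 3%N isT.
have n4 := lt 4%N isT.
have NJ k x : (k < n)%N -> J k (- x) = - J k x by move=> nk; exact: linopN (lJ k nk).
(* Three factors are needed: a product of two would be skew with square -1. Being odd in number,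
   they also give a sign change when [J_4] is moved across. *)
pose s := J 3%N \o (J 1%N \o J 2%N).
have sE x : s x = J 3%N (J 1%N (J 2%N x)) by [].
have Ms : M s := vna_comp vM (MJ _ n3) (vna_comp vM (MJ _ n1) (MJ _ n2)).
have ss x : s (s x) = x.
  rewrite !sE (JC 2%N 3%N) // (JC 2%N 1%N) // !NJ // (JC 1%N 3%N) // !NJ // !opprK.
  by rewrite !Jsq // !opprK.
have as_ : is_adjoint s s.
  move=> x y; rewrite !sE !aJ // !opprK -innerNr.
  by rewrite (JC 1%N 3%N) // NJ // (JC 2%N 3%N) // (JC 2%N 1%N) // NJ // !opprK.
have sJ4 x : s (J 4%N x) = - J 4%N (s x).
  by rewrite !sE (JC 2%N 4%N) // !NJ // (JC 1%N 4%N) // !NJ // (JC 3%N 4%N) // !opprK.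
have ls := vna_lin vM Ms.
pose P : L -> L := 2^-1 *: (idfun + s).
have PE x : P x = 2^-1 *: (x + s x) by [].
have MP : M P by apply: vna_scale => //; apply: vna_add => //; exact: vna_id.
clearbody P s.
have half (v : L) : 2^-1 *: (v + v) = v.
  by rewrite -[v + v](scaler_nat 2) scalerA mulVf ?pnatr_eq0 // scale1r.
have pP : vna_projection (M := M) P.
  split; first exact: MP.
  - by move=> x y; rewrite !PE !innerE as_.
  - move=> x; rewrite !PE (linopZ _ _ ls) (linopD _ _ ls) ss [s x + x]addrC.
    by rewrite -scalerDr half.
have [y y0] := frame_nonzero n0.
have redM := vna_reduced K_nonempty K_compact K_hausdorff vM isoF.
have := vna_projection_central vM redM y pP (MJ _ n4).
rewrite !PE (linopZ _ _ (lJ _ n4)) (linopD _ _ (lJ _ n4)) sJ4.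
have half0 : 2^-1 != 0 :> R by rewrite invr_neq0 // pnatr_eq0.
(* Commutation of [P] with [J_4] now reads [- J_4 s y = J_4 s y], so [s y = 0] although [s] is an
   involution. *)
move=> /(scalerI half0)/addrI/eqP; rewrite eq_sym -addr_eq0 -mulr2n -scaler_nat scaler_eq0.
rewrite pnatr_eq0 /= -normr_eq0 J1 // normr_eq0 => /eqP sy.
by move/eqP: y0; apply; rewrite -(ss y) sy linop0.
Qed.

End Frame.
End MainTheorem.

Theorem theorem2p2 (R : realType) (K : topologicalType) (H : hilbertType R)
    (K_nonempty : [set: K] !=set0)
    (K_compact : compact [set: K])
    (K_hausdorff : hausdorff_space K)
    (dimH : hilbert_dim_eq H 3 \/ hilbert_dim_ge H 5) :
  ~ exists (L : hilbertType R) (M : set (L -> L)) (F : (K -> H) -> (L -> L)),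
      real_von_neumann_algebra M /\
      surjective_isometry
        (unit_sphere (@C_space K R H) (@sup_norm K R H)) (@sup_norm K R H)
        (unit_sphere M (@operator_norm R L)) (@operator_norm R L) F.
Proof.
move=> [L [M [F [vM isoF]]]].
case: dimH => [[B oB cB]|[B oB cB]].
  have [e [oe total]] := orthonormal_family_total oB cB.
  exact: (frame_not3 K_nonempty K_compact K_hausdorff vM isoF oe).
have [e [_ oe]] := orthonormal_family oB cB.
by have := frame_lt5 K_nonempty K_compact K_hausdorff vM isoF oe.
Qed.
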